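(* Let $A=(A_{ij})\in\mathbb{R}_{\min}^{n\times n}$ and let $\Gamma=(\gamma_1\le\cdots\le\gamma_n)$ be the sequence of min-plus algebraic eigenvalues of $A$. Let $\mathcal{A}\in\mathcal{C}^{n\times n}$ satisfy $(\mathcal{A}_\epsilon)_{ij}\simeq a_{ij}\epsilon^{A_{ij}}$ for all $i,j$, with $a=(a_{ij})\in\mathbb{C}^{n\times n}$. For generic values of $a=(a_{ij})\in\mathbb{C}^{n\times n}$, the eigenvalues $\mathcal{L}^1_\epsilon,\dots,\mathcal{L}^n_\epsilon$ of $\mathcal{A}_\epsilon$ (counted with multiplicities) have first order asymptotics, $\mathcal{L}^i_\epsilon\sim\lambda_i\epsilon^{\Lambda_i}$, and $\Lambda=(\Lambda_1\le\cdots\le\Lambda_n)$ satisfies $\Lambda=\Gamma$.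
   Context: A property $\mathscr{P}(y)$ depending on $y\in\mathbb{C}^N$ holds for generic values of $y$ if there is a non-zero polynomial $Q\in\mathbb{C}[\mathsf{Y}_1,\dots,\mathsf{Y}_N]$ such that $\mathscr{P}(y)$ is true whenever $Q(y)\ne0$. Here the matrix $A$ is fixed, and the property of $a\in\mathbb{C}^{n\times n}$ is that the conclusion holds for any $\mathcal{A}\in\mathcal{C}^{n\times n}$ satisfying $(\mathcal{A}_\epsilon)_{ij}\simeq a_{ij}\epsilon^{A_{ij}}$ for all $i,j$. $\mathcal{C}$ is the ring of germs at $0^+$ of continuous functions $f:(0,\epsilon_0)\to\mathbb{C}$ (some $\epsilon_0>0$) such that $|f(\epsilon)|\le\epsilon^{-k}$ on $(0,\epsilon_0)$ for some constant $k>0$ (functions coinciding near $0$ are identified). For $f\in\mathcal{C}$, $a\in\mathbb{C}$, $A\in\mathbb{R}\cup\{+\infty\}$: $f(\epsilon)\simeq a\epsilon^A$ means $\lim_{\epsilon\to0^+}\epsilon^{-A}f(\epsilon)=a$ if $A\in\mathbb{R}$, and $f=0$ (near $0$) if $A=+\infty$. One says that $f\in\mathcal{C}$ has first order asymptotics, $f\sim a\epsilon^A$, if $f\simeq a\epsilon^A$ and either $A\in\mathbb{R}$, $a\ne0$, or $A=+\infty$. $\mathcal{A}_\epsilon$ is the value at $\epsilon$ of (a representative of) $\mathcal{A}$. $\mathbb{R}_{\min}=\mathbb{R}\cup\{+\infty\}$ is the min-plus semifield, with addition $a\oplus b=\min(a,b)$, multiplication $ab=a+b$ (usual sum), zero element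 $+\infty$ and unit element $0$. A formal polynomial $P=\bigoplus_{k=0}^n P_k\mathsf{Y}^k$ of degree $n$ over $\mathbb{R}_{\min}$ (so $P_n\ne+\infty$) has associated polynomial function $\widehat P(y)=\min_k(P_k+ky)$, $y\in\mathbb{R}_{\min}$ (the term $k=0$ being $P_0$). It factors uniquely as $\widehat P(y)=P_n+\sum_{i=1}^n\min(y,c_i)$ with $c_1\le\cdots\le c_n$ in $\mathbb{R}_{\min}$; the $c_i$ are the (min-plus) roots of $P$. For $A\in\mathbb{R}_{\min}^{n\times n}$, the min-plus characteristic polynomial is $P_A=\bigoplus_{k=0}^n (P_A)_k\mathsf{Y}^k$ with $(P_A)_n=0$ and, for $0\le k\le n-1$, $(P_A)_k=\min_{J\subset[n],\,\#J=n-k}\ \min_{\sigma\in\mathfrak{S}_J}\sum_{j\in J}A_{j\sigma(j)}$, where $[n]=\{1,\dots,n\}$ and $\mathfrak{S}_J$ is the set of permutations of $J$. The min-plus algebraic eigenvalues of $A$ are the $n$ roots of $P_A$. *)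

(* Defs.v *)
From HB Require Import structures.
From mathcomp Require Import all_boot all_order all_algebra all_fingroup.
From mathcomp Require Import complex.
From mathcomp Require Import -(notations) mpoly.
From mathcomp Require Import all_classical all_reals all_analysis.
Import Order.TTheory GRing.Theory Num.Theory.
Import numFieldNormedType.Exports.

Set Implicit Arguments.
Unset Strict Implicit.
Unset Printing Implicit Defensive.

Local Open Scope classical_set_scope.
Local Open Scope ring_scope.
Local Open Scope complex_scope.

(* The min-plus semifield R U {+oo} is the part of \bar R away from -oo. *)
Definition in_Rmin (R : realType) (x : \bar R) : Prop := x <> -oo%E.

(* [P k] is the coefficient of Y^k, for 0 <= k <= n. In \bar R, y *+ 0 = 0 even
   for y = +oo, so the term k = 0 is P_0. *)
Definition mp_eval (R : realType) (n : nat) (P : 'I_n.+1 -> \bar R)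
    (y : \bar R) : \bar R :=
  (\big[Order.min/+oo]_(k < n.+1) (P k + y *+ k))%E.

Definition mp_roots (R : realType) (n : nat) (P : 'I_n.+1 -> \bar R)
    (c : n.-tuple (\bar R)) : Prop :=
  [/\ forall i : 'I_n, in_Rmin (tnth c i),
      forall i j : 'I_n, (i <= j)%N -> (tnth c i <= tnth c j)%E
    & forall y : \bar R, in_Rmin y ->
        mp_eval P y =
        (P ord_max + \sum_(i < n) Order.min y (tnth c i))%E].

Definition mp_char_poly (R : realType) (n : nat) (A : 'M[\bar R]_n)
    (k : 'I_n.+1) : \bar R :=
  if k == n :> nat then 0%E else
  (\big[Order.min/+oo]_(J : {set 'I_n} | #|J| == (n - k)%N)
     \big[Order.min/+oo]_(s : 'S_n | perm_on J s) \sum_(j in J) A j (s j))%E.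

Definition mp_eigenvalues (R : realType) (n : nat) (A : 'M[\bar R]_n)
    (Gamma : n.-tuple (\bar R)) : Prop :=
  mp_roots (mp_char_poly A) Gamma.

(* [f] represents an element of the ring of germs at 0^+; its values outside
   the interval ]0, e0[ are irrelevant. The regular-module copy R[i]^o carries
   the topology of the modulus. *)
Definition is_germ (R : realType) (f : R -> R[i]) : Prop :=
  exists e0 k : R, [/\ 0 < e0, 0 < k,
    {in `]0, e0[, continuous (f : R -> R[i]^o)}
    & {in `]0, e0[, forall e : R, `|f e| <= (e `^ (- k))%:C}].

Definition asymp_eq (R : realType) (f : R -> R[i]) (a : R[i]) (A : \bar R) :
    Prop :=
  match A with
  | EFin r =>
      (fun e : R => (e `^ (- r))%:C * f e : R[i]^o) @ 0^'+ --> (a : R[i]^o)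
  | +oo%E => \forall e \near 0^'+, f e = 0
  | -oo%E => False
  end.

Definition first_order_asymp (R : realType) (f : R -> R[i]) (a : R[i])
    (A : \bar R) : Prop :=
  asymp_eq f a A /\ ((A \is a fin_num /\ a <> 0) \/ A = +oo%E).

Definition eigenvalue_germs (R : realType) (n : nat) (M : R -> 'M[R[i]]_n)
    (L : 'I_n -> R -> R[i]) : Prop :=
  (forall i, is_germ (L i)) /\
  \forall e \near 0^'+, char_poly (M e) = \prod_(i < n) ('X - (L i e)%:P).

Definition generic (R : realType) (N : nat) (P : 'rV[R[i]]_N -> Prop) : Prop :=
  exists Q : mpoly N R[i], Q <> 0 /\
    forall y : 'rV[R[i]]_N, meval (fun k : 'I_N => y 0 k) Q <> 0 -> P y.

(* A matrix is identified with the vector of its n * n entries by [vec_mx]. *)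
Definition generic_mx (R : realType) (n : nat) (P : 'M[R[i]]_n -> Prop) : Prop :=
  generic (fun y : 'rV[R[i]]_(n * n) => P (vec_mx y)).

(* Main.v *)
Require Import Defs.
From HB Require Import structures.
From mathcomp Require Import all_boot all_order all_algebra all_fingroup.
From mathcomp Require Import complex separable.
From mathcomp Require Import -(notations) mpoly.
From mathcomp Require Import all_classical all_reals all_analysis.
From mathcomp Require Import ring lra zify.
Import Order.TTheory GRing.Theory Num.Theory.
Import numFieldNormedType.Exports.
Import Normc.

(** The characteristic polynomial of [calA e] is a signed sum of monomials
    [\prod_(j in J) calA e j (s j) * Y ^+ (n - #|J|)], one for each permutation
    [s] of a subset [J]. For a finite [gamma] in [Gamma], substituting
    [Y := e ^ gamma * Y] and dividing by the right power of [e] makes it converge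
    to the sum of the monomials that are tight at [gamma]. The degrees of these
    range exactly over the jump of slope of the min-plus polynomial function at
    [gamma], so this leading polynomial has as many nonzero roots as [gamma] has
    occurrences in [Gamma]. Being affine in each entry of [a], it has simple
    nonzero roots for generic [a]. Near [0] the eigenvalues are therefore
    separated by disjoint discs of radius [rho * e ^ gamma] around the points
    [lambda * e ^ gamma], except for identically zero ones: simplicity yields
    their continuity, and a continuous eigenvalue cannot leave its disc. *)

Set Implicit Arguments.
Unset Strict Implicit.
Unset Printing Implicit Defensive.

Local Open Scope classical_set_scope.
Local Open Scope ring_scope.
Local Open Scope complex_scope.

(** * Multiaffine polynomial families with generically simple roots *)

(** Simplicity for generic [a] means that a certain discriminant, as a polynomial in the entries, is
    not identically zero. One good choice of entries must therefore be shown to exist, although the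
    set of tight monomials is not explicit. Two facts make this possible. Distinct terms [(J, s)]
    have distinct squarefree monomials, so nothing cancels. Changing one entry moves the leading
    polynomial along a pencil [H + s *: G], whose double roots are, for all but finitely many [s],
    double roots of both [H] and [G]. On the analytic side, only the existence of one root per disc
    is proved by estimates; that nothing else is left follows from counting degrees. The zero
    eigenvalues come from a power of ['X] that divides every monomial of finite weight. The
    conclusion concerns every continuous labelling of the eigenvalues, so it is not enough to
    construct one. *)

Lemma coefM_bound (K : nzRingType) (p q : {poly K}) (m n : nat) :
  (size p <= m.+1)%N -> (size q <= n.+1)%N -> (p * q)`_(m + n) = p`_m * q`_n.
Proof.
move=> sp sq; rewrite coefM.
have lt_m : (m < (m + n).+1)%N by rewrite ltnS leq_addr.
rewrite (bigD1 (Ordinal lt_m)) //= addKn big1 ?addr0 // => i ne_im.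
have [lt_im|] := ltnP i m.
  by rewrite [q`__]nth_default ?mulr0 //; apply: leq_trans sq _; lia.
rewrite leq_eqVlt eq_sym => /orP[/eqP e|lt_mi].
  by case/eqP: ne_im; apply: val_inj.
by rewrite [p`_i]nth_default ?mul0r //; apply: leq_trans sp _.
Qed.

(** Subtracting a multiple of [G] gives a solution [K] of the same equation with zero coefficient in
    degree [deg G]. If [K] were nonzero, the top coefficients of [X K' G = K X G'] would force
    [deg K = deg G] in characteristic zero, a contradiction. *)
Lemma wronskian0 (C : numFieldType) (G H : {poly C}) :
  G != 0 -> H^`() * G = H * G^`() -> exists c, H = c *: G.
Proof.
move=> G0 W; set d := (size G).-1.
have szG : size G = d.+1 by rewrite /d prednK // size_poly_gt0.
have Gd : G`_d != 0 by rewrite -[G`_d]/(lead_coef G) lead_coef_eq0.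
exists (H`_d / G`_d); apply/eqP; rewrite -subr_eq0.
set K := H - _; apply/eqP.
have Kd : K`_d = 0 by rewrite !coefE divfK // subrr.
have WK : K^`() * G = K * G^`().
  by rewrite /K derivB derivZ !mulrBl W -scalerAl -scalerAl [G * _]mulrC.
apply/eqP/negPn/negP => K0.
set k := (size K).-1.
have szK : size K = k.+1 by rewrite /k prednK // size_poly_gt0.
have Kk : K`_k != 0 by rewrite -[K`_k]/(lead_coef K) lead_coef_eq0.
have szXd (p : {poly C}) m : size p = m.+1 -> (size ('X * p^`())%R <= m.+1)%N.
  move=> e; apply: leq_trans (size_polyMleq _ _) _; rewrite size_polyX /=.
  by rewrite -e lt_size_deriv // -size_poly_gt0 e.
(* After multiplication by ['X], derivation acts on degree [m] as multiplication by [m], so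
   constants need no separate case. *)
have coefXd (p : {poly C}) m : ('X * p^`())`_m = p`_m *+ m.
  by rewrite coefXM coef_deriv; case: m => [|m]; rewrite ?mulr0n.
have eX : 'X * K^`() * G = K * ('X * G^`()) by rewrite -mulrA WK mulrCA.
have eK := coefM_bound (szXd _ _ szK) (eq_leq szG).
have eG := coefM_bound (eq_leq szK) (szXd _ _ szG).
have ekd : k = d.
  move: eG; rewrite -eX eK !coefXd mulrnAl mulrnAr; apply: mulrIn.
  exact: mulf_neq0.
by rewrite ekd Kd eqxx in Kk.
Qed.

(** At a double root [y], the values of [H] and [H'] are [- s] times those of [G] and [G'], so the
    Wronskian [H' G - H G'] vanishes there. If it is not the zero polynomial, [y] is one of finitely
    many points, each of which determines [s] unless [G] and [G'] both vanish at it. Otherwise [H]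
    is a multiple of [G] and a single [s] is bad. *)
Lemma pencil_double_root (C : numClosedFieldType) (G H : {poly C}) :
  exists B : seq C, forall s y, s \notin B ->
    (H + s *: G).[y] = 0 -> (H^`() + s *: G^`()).[y] = 0 ->
    [/\ H.[y] = 0, G.[y] = 0, H^`().[y] = 0 & G^`().[y] = 0].
Proof.
have [->|G0] := eqVneq G 0.
  by exists [::] => s y _; rewrite derivC !scaler0 !addr0 horner0.
have [W|W] := eqVneq (H^`() * G) (H * G^`()).
  have [c ->] := wronskian0 G0 W; exists [:: - c] => s y.
  rewrite inE -addr_eq0 addrC => sc.
  rewrite derivZ -!scalerDl !hornerZ => /eqP; rewrite mulf_eq0 (negPf sc) /=.
  move=> /eqP-> /eqP; rewrite mulf_eq0 (negPf sc) /= => /eqP->.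
  by rewrite !mulr0.
move: W; rewrite -subr_eq0; set W := _ - _ => W0.
have [rs Wrs] := closed_field_poly_normal W.
exists ([seq - H.[y] / G.[y] | y <- rs] ++
        [seq - H^`().[y] / G^`().[y] | y <- rs]) => s y.
rewrite mem_cat negb_or => /andP[sB1 sB2].
rewrite !hornerD !hornerZ => /eqP; rewrite addr_eq0 => /eqP eH.
move=> /eqP; rewrite addr_eq0 => /eqP eH'.
have yrs : y \in rs.
  have: W.[y] == 0 by rewrite /W !hornerE eH eH'; apply/eqP; ring.
  by rewrite Wrs hornerZ mulf_eq0 lead_coef_eq0 (negPf W0) /= -rootE root_prod_XsubC.
have Gy : G.[y] = 0.
  apply/eqP/negPn/negP => Gy; case/negP: sB1; apply/mapP; exists y => //.
  by rewrite eH opprK mulfK.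
have Gy' : G^`().[y] = 0.
  apply/eqP/negPn/negP => Gy'; case/negP: sB2; apply/mapP; exists y => //.
  by rewrite eH' opprK mulfK.
by rewrite eH eH' Gy Gy' !mulr0 oppr0.
Qed.

Lemma exists_notin (C : numDomainType) (B : seq C) : exists s : C, s \notin B.
Proof.
apply/not_existsP => inB.
have U : uniq [seq i%:R : C | i <- iota 0 (size B).+1].
  by rewrite map_inj_uniq ?iota_uniq // => i j /eqP; rewrite eqr_nat => /eqP.
have sub : {subset [seq i%:R : C | i <- iota 0 (size B).+1] <= B}.
  by move=> x _; apply/negPn/negP/inB.
by have := uniq_leq_size U sub; rewrite size_map size_iota ltnn.
Qed.

Definition update (I : eqType) (X : Type) (a : I -> X) (i : I) (s : X) : I -> X :=
  fun j => if j == i then s else a j.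

Lemma update_id (I : eqType) (X : Type) (a : I -> X) i : update a i (a i) = a.
Proof. by apply/funext => j; rewrite /update; case: eqP => [->|]. Qed.

(** [S] acts as a Zariski dense set: every coordinate line through one of its points meets it twice.
    The induction is on the list of coordinates where [b] may differ from a point of [S]; an affine
    function of one variable with two zeros is zero. *)
Lemma coordinatewise_affine_eq0 (I : finType) (C : fieldType)
    (S : (I -> C) -> Prop) (f : (I -> C) -> C) :
  (exists a, S a) ->
  (forall a i, S a -> exists s t, [/\ s != t, S (update a i s) & S (update a i t)]) ->
  (forall a i, exists u v, forall s, f (update a i s) = u + s * v) ->
  (forall a, S a -> f a = 0) -> forall b, f b = 0.
Proof.
move=> [a0 Sa0] Smove faff fS b.
suff: forall (l : seq I) a b, S a -> (forall j, j \notin l -> b j = a j) -> f b = 0.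
  by move=> /(_ (enum I) a0 b Sa0); apply=> j; rewrite mem_enum.
elim=> [|i l IH] {a0 Sa0 b} a b Sa ab.
  by rewrite (_ : b = a) ?fS //; apply/funext => j; apply: ab.
have [s [t [st Ss St]]] := Smove a i Sa.
have fupd x : S (update a i x) -> f (update b i x) = 0.
  move=> Sx; apply: (IH _ _ Sx) => j jl; rewrite /update.
  by case: eqP => // /eqP ji; apply: ab; rewrite inE negb_or ji.
have [u [v fE]] := faff b i.
have es := fupd s Ss; have et := fupd t St; rewrite !fE in es et.
have v0 : v = 0.
  have /eqP : (s - t) * v = 0 by rewrite -[RHS](subrr 0) -{1}es -et; ring.
  by rewrite mulf_eq0 subr_eq0 (negPf st) => /eqP.
have u0 : u = 0 by move: et; rewrite v0 mulr0 addr0.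
by rewrite -(update_id b i) fE u0 v0 mulr0 addr0.
Qed.

Section SparsePoly.
Variables (I T : finType) (E : T -> {set I}) (k : T -> nat) (sg : T -> bool).

(** The coefficient ring is a parameter so that the family can be taken over numbers and over
    polynomials in the entries. Each [E t] being a set, every coefficient is affine in each
    [a i]. *)
Definition sparse_poly (K : comNzRingType) (P : pred T) (a : I -> K) : {poly K} :=
  \sum_(t | P t) ((-1) ^+ sg t * \prod_(i in E t) a i) *: 'X^(k t).

(** Reduces the nonvanishing of a coefficient to that of a value of a subfamily. *)
Lemma coef_sparse_poly (K : comNzRingType) (P : pred T) (a : I -> K) j :
  (sparse_poly P a)`_j = (sparse_poly (fun t => P t && (k t == j)) a).[1].
Proof.
rewrite coef_sum horner_sum [RHS]big_mkcondr; apply: eq_bigr => t _.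
by rewrite coefZ coefXn hornerZ hornerXn expr1n eq_sym; case: eqP; rewrite ?mulr0.
Qed.

Lemma map_sparse_poly (K L : comNzRingType) (f : {rmorphism K -> L}) P (a : I -> K) :
  map_poly f (sparse_poly P a) = sparse_poly P (f \o a).
Proof.
rewrite /sparse_poly rmorph_sum; apply: eq_bigr => t _.
by rewrite /= map_polyZ map_polyXn rmorphM rmorph_sign rmorph_prod.
Qed.

Lemma sparse_poly_update (K : comNzRingType) P (a : I -> K) i :
  exists H G, forall s, sparse_poly P (update a i s) = H + s *: G.
Proof.
exists (sparse_poly (fun t => P t && (i \notin E t)) a).
exists (\sum_(t | P t && (i \in E t))
          ((-1) ^+ sg t * \prod_(j in E t :\ i) a j) *: 'X^(k t)) => s.
rewrite /sparse_poly (bigID (fun t => i \in E t)) /= addrC scaler_sumr.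
congr (_ + _); apply: eq_bigr => t /andP[_ it].
  congr ((_ * _) *: _); apply: eq_bigr => j jt; rewrite /update.
  by case: eqP => // ji; rewrite -ji jt in it.
rewrite (bigD1 i) //= scalerA mulrCA /update eqxx; congr ((_ * (_ * _)) *: _).
under [RHS]eq_bigl do rewrite in_setD1 andbC.
by apply: eq_bigr => j /andP[_ /negPf->].
Qed.

(** Taking for [a] the indicator of an [E t0] of least cardinality kills all other monomials, since
    no other edge set is contained in [E t0]. *)
Lemma sparse_poly_neq0 (C : fieldType) (P : pred T) (y : C) :
  {in P &, injective E} -> (exists t, P t) -> y != 0 ->
  exists a, (sparse_poly P a).[y] != 0.
Proof.
move=> Einj [t1 Pt1] y0.
case: (@arg_minnP T t1 P (fun t => #|E t|) Pt1) => t0 Pt0 t0min.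
exists (fun i => (i \in E t0)%:R).
rewrite horner_sum (bigD1 t0) //= [X in _ + X]big1 => [|t /andP[Pt tt0]].
  rewrite addr0 hornerZ hornerXn big1 => [|i ->//].
  by rewrite mulr1 mulf_neq0 ?expf_neq0 // oppr_eq0 oner_eq0.
have /subsetPn[i it it0] : ~~ (E t \subset E t0).
  apply: contra tt0 => sub; apply/eqP/Einj => //.
  by apply/eqP; rewrite eqEcard sub t0min.
by rewrite (bigD1 i) //= (negPf it0) mul0r mulr0 scale0r horner0.
Qed.

Lemma coef_sparse_poly_neq0 (C : fieldType) (P : pred T) (j : nat) :
  {in P &, injective E} -> (exists2 t, P t & k t = j) ->
  exists a : I -> C, (sparse_poly P a)`_j != 0.
Proof.
move=> Einj [t Pt kt].
have [|||a] := @sparse_poly_neq0 C (fun t => P t && (k t == j)) 1.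
- by move=> t1 t2 /andP[P1 _] /andP[P2 _]; apply: Einj.
- by exists t; rewrite Pt kt eqxx.
- exact: oner_neq0.
by exists a; rewrite coef_sparse_poly.
Qed.

Lemma size_sparse_poly (K : comNzRingType) (P : pred T) (a : I -> K) hi :
  (forall t, P t -> (k t <= hi)%N) -> (size (sparse_poly P a) <= hi.+1)%N.
Proof.
move=> khi; apply: leq_trans (size_sum _ _ _) _; apply/bigmax_leqP => t Pt.
by apply: leq_trans (size_scale_leq _ _) _; rewrite size_polyXn ltnS khi.
Qed.

(* The set [S] of coefficients whose double roots all lie in a fixed list of
   least possible length is stable under generic moves of one coordinate, by
   [pencil_double_root]; a double root [y] common to all of [S] would make the
   multiaffine function [a |-> (sparse_poly P a).[y]] vanish identically. *)
Lemma exists_sparse_poly_simple (C : numClosedFieldType) (P : pred T) (lo hi : nat) :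
  {in P &, injective E} ->
  (exists2 t, P t & k t = lo) -> (exists2 t, P t & k t = hi) ->
  exists a : I -> C, let F := sparse_poly P a in
    [/\ F`_lo != 0, F`_hi != 0 &
        forall y, y != 0 -> F.[y] = 0 -> F^`().[y] <> 0].
Proof.
move=> Einj exlo exhi.
pose F (a : I -> C) := sparse_poly P a.
pose good a := (F a)`_lo != 0 /\ (F a)`_hi != 0.
pose double a y := [/\ y != 0, (F a).[y] = 0 & (F a)^`().[y] = 0].
pose covered a (l : seq C) := forall y, double a y -> y \in l.
have coef_move a i j : (F a)`_j != 0 ->
    exists B : seq C, forall s, s \notin B -> (F (update a i s))`_j != 0.
  have [H [G e]] := sparse_poly_update P a i.
  rewrite -{1}(update_id a i) /F e !coefE => nz.
  exists [:: - H`_j / G`_j] => s; rewrite inE e !coefE; apply: contra => /eqP HG.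
  have [G0|G0] := eqVneq G`_j 0.
    by move: HG nz; rewrite G0 !mulr0 => ->; rewrite eqxx.
  by apply/eqP; move/eqP: HG; rewrite addr_eq0 => /eqP->; rewrite opprK mulfK.
have two_notin (B : seq C) : exists s t, [/\ s != t, s \notin B & t \notin B].
  have [s sB] := exists_notin B; have [t] := exists_notin (s :: B).
  by rewrite inE negb_or eq_sym => /andP[st tB]; exists s, t.
have coef_aff j a i : exists u v, forall s, (F (update a i s))`_j = u + s * v.
  have [H [G e]] := sparse_poly_update P a i.
  by exists H`_j, G`_j => s; rewrite /F e !coefE.
have horner_aff y a i : exists u v, forall s, (F (update a i s)).[y] = u + s * v.
  have [H [G e]] := sparse_poly_update P a i.
  by exists H.[y], G.[y] => s; rewrite /F e !hornerE.
(* If the two coefficients were never nonzero together, the one of degree [hi] would vanish wherever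
   the one of degree [lo] does not, hence everywhere. *)
have exgood : exists a, good a.
  apply/not_existsP => ngood.
  have [b /eqP] := @coef_sparse_poly_neq0 C P hi Einj exhi; apply.
  apply: (@coordinatewise_affine_eq0 _ _ (fun a => (F a)`_lo != 0) (fun a => (F a)`_hi)) => //.
  - exact: coef_sparse_poly_neq0.
  - move=> a i /(coef_move _ i)[B sB].
    by have [s [t [st s_B t_B]]] := two_notin B; exists s, t; split=> //; apply: sB.
  - by move=> a alo; apply/eqP/negPn/negP => ahi; apply: (ngood a).
have excov a : good a -> exists l, covered a l.
  move=> [alo _]; have [rs e] := closed_field_poly_normal (F a).
  have F0 : F a != 0 by apply: contraNneq alo => ->; rewrite coef0.
  exists rs => y [_ Fy _]; move/eqP: Fy.
  by rewrite e hornerZ mulf_eq0 lead_coef_eq0 (negPf F0) /= -rootE root_prod_XsubC.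
have exm : exists m, `[< exists a l, [/\ good a, covered a l & size l = m] >].
  have [a ga] := exgood; have [l cl] := excov a ga.
  by exists (size l); apply/asboolP; exists a, l.
case: (ex_minnP exm) => m /asboolP[a0 [l0 [ga0 ca0 szl0]]] mmin.
have Smove a i : good a -> covered a l0 ->
    exists B : seq C, forall s, s \notin B ->
      good (update a i s) /\ covered (update a i s) l0.
  move=> [alo ahi] cl; have [B1 B1P] := coef_move _ i _ alo.
  have [B2 B2P] := coef_move _ i _ ahi.
  have [H [G e]] := sparse_poly_update P a i.
  have [B3 B3P] := pencil_double_root G H.
  exists (B1 ++ B2 ++ B3) => s; rewrite !mem_cat !negb_or => /and3P[s1 s2 s3].
  split; first by split; [apply: B1P | apply: B2P].
  move=> y [y0]; rewrite /F e derivD derivZ => r1 r2; apply: cl; split=> //;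
    have [h1 h2 h3 h4] := B3P _ _ s3 r1 r2;
    by rewrite -(update_id a i) /F e ?(derivD, derivZ) !hornerE ?h1 ?h2 ?h3 ?h4 mulr0 addr0.
exists a0; case: ga0 => alo ahi; split=> // y y0 Fy F'y.
have : y \in l0 by apply: ca0.
move=> yl0.
have [b /eqP] := sparse_poly_neq0 Einj (let: ex_intro2 t Pt _ := exlo in ex_intro _ t Pt) y0.
apply; apply: (@coordinatewise_affine_eq0 _ _ (fun a => good a /\ covered a l0)
                (fun a => (F a).[y])) => //; first by exists a0.
  move=> a i [ga ca]; have [B BP] := Smove a i ga ca.
  by have [s [t [st /BP sB /BP tB]]] := two_notin B; exists s, t.
(* If [y] is not a root at [a], then [rem y l0] still covers the double roots at [a], against the
   minimality of [l0]. *)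
move=> a [ga ca]; apply/eqP/negPn/negP => Fay.
suff /mmin : `[< exists a l, [/\ good a, covered a l & size l = (size l0).-1] >].
  by rewrite -szl0; case: (l0) yl0 => //= x l _; rewrite ltnn.
apply/asboolP; exists a, (rem y l0); split=> //; last by rewrite size_rem.
move=> z dz; have zl := ca z dz.
have zy : z != y by apply: contraNneq Fay => <-; case: dz => _ /eqP.
by move/perm_mem: (perm_to_rem yl0) => /(_ z); rewrite zl inE (negPf zy).
Qed.

End SparsePoly.

(* [map_resultant] is stated only for coefficients that are polynomials. *)
Lemma map_poly_resultant (K L : nzRingType) (f : {rmorphism K -> L}) (p q : {poly K}) :
  f (lead_coef p) != 0 -> f (lead_coef q) != 0 ->
  f (resultant p q) = resultant (map_poly f p) (map_poly f q).
Proof.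
move=> nzp nzq; rewrite /resultant /Sylvester_mx !size_map_poly_id0 //.
rewrite -det_map_mx /= map_col_mx; congr (\det (col_mx _ _)).
all: by apply/matrixP => i j; rewrite !mxE /= !rVpoly_delta !coefXnM coef_map;
  case: ifP; rewrite ?rmorph0.
Qed.

Section Generic.
Variables (I T : finType) (E : T -> {set I}) (k : T -> nat) (sg : T -> bool).

(** [Q] is the product of the constant coefficient, the top coefficient and the resultant with the
    derivative, formed over polynomials in the entries. Where the top coefficient survives,
    specialization preserves both degrees and so commutes with the resultant;
    [exists_sparse_poly_simple] gives a point where [Q] is nonzero. *)
Lemma generic_sparse_poly_simple (C : numClosedFieldType) (N : nat) (idx : I -> 'I_N)
    (P : pred T) (hi : nat) :
  injective idx -> {in P &, injective E} -> (0 < hi)%N ->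
  (forall t, P t -> (k t <= hi)%N) ->
  (exists2 t, P t & k t = 0%N) -> (exists2 t, P t & k t = hi) ->
  exists2 Q : mpoly N C, Q != 0 & forall y : 'I_N -> C, meval y Q != 0 ->
    let F := sparse_poly E k sg P (y \o idx) in
    [/\ F`_0 != 0, size F = hi.+1 & coprimep F F^`()].
Proof.
move=> idx_inj Einj hi0 khi ex0 exhi.
pose Fm : {poly mpoly N C} := sparse_poly E k sg P (fun i => mpolyX C (mnm1 (idx i))).
have FmE y : map_poly (meval y) Fm = sparse_poly E k sg P (y \o idx).
  rewrite map_sparse_poly; congr sparse_poly.
  by apply/funext => i /=; rewrite mevalXU.
have coefE y j : meval y Fm`_j = (sparse_poly E k sg P (y \o idx))`_j.
  by rewrite -FmE coef_map.
have szF (y : 'I_N -> C) : (sparse_poly E k sg P (y \o idx))`_hi != 0 ->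
    size (sparse_poly E k sg P (y \o idx)) = hi.+1.
  move=> nz; apply/eqP; rewrite eqn_leq size_sparse_poly //=.
  by rewrite ltnNge; apply: contra nz => /leq_sizeP->.
pose Q := Fm`_0 * Fm`_hi * resultant Fm Fm^`().
have QE y : (sparse_poly E k sg P (y \o idx))`_hi != 0 ->
    let F := sparse_poly E k sg P (y \o idx) in
    meval y Q = F`_0 * F`_hi * resultant F F^`().
  move=> nz F.
  have szm : size Fm = hi.+1.
    apply/eqP; rewrite eqn_leq size_sparse_poly //=.
    rewrite ltnNge; apply: contra nz => /leq_sizeP /(_ hi (leqnn _)) e.
    by rewrite -coefE e meval0.
  have szm' : size Fm^`() = hi.
    apply/eqP; rewrite eqn_leq -ltnS -szm lt_size_deriv -?size_poly_gt0 ?szm //=.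
    rewrite -(prednK hi0) ltnNge; apply: contra nz => /leq_sizeP /(_ _ (leqnn _)).
    rewrite coef_deriv prednK // -coefE => /(congr1 (meval y)).
    rewrite mevalMn meval0 => /eqP; rewrite mulrn_eq0.
    by rewrite gtn_eqF.
  rewrite /Q !mevalM !coefE map_poly_resultant.
  - by rewrite -deriv_map FmE.
  - by rewrite lead_coefE szm /= coefE.
  - rewrite lead_coefE szm' coef_deriv prednK // rmorphMn /= coefE.
    by rewrite mulrn_eq0 negb_or gtn_eqF.
have res_coprime (y : 'I_N -> C) : (sparse_poly E k sg P (y \o idx))`_hi != 0 ->
  let F := sparse_poly E k sg P (y \o idx) in
  (resultant F F^`() != 0) = coprimep F F^`().
  move=> nz F; rewrite resultant_eq0 -leqNgt /coprimep eqn_leq.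
  rewrite size_poly_gt0 gcdp_eq0 andbC negb_and.
  by rewrite (_ : F != 0) // -size_poly_gt0 szF.
exists Q.
  have [a [a0 ahi simple]] := exists_sparse_poly_simple sg C Einj ex0 exhi.
  pose y (j : 'I_N) := oapp a 0 [pick i | idx i == j].
  have ya : y \o idx = a.
    apply/funext => i; rewrite /y /=; case: pickP => [j /eqP/idx_inj->//|/(_ i)].
    by rewrite eqxx.
  apply/eqP => Q0; have := QE y; rewrite ya => /(_ ahi)/esym/eqP.
  rewrite Q0 meval0 !mulf_eq0 (negPf a0) (negPf ahi) /=; apply/negP.
  have := res_coprime y; rewrite ya => /(_ ahi)->; rewrite coprimep_def.
  apply/negPn/negP => /closed_rootP[x]; rewrite root_gcd => /andP[/rootP Fx /rootP].
  apply: simple => //; apply: contraNneq a0 => x0.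
  by move/eqP: Fx; rewrite x0 horner_coef0.
move=> y Qy F.
have hinz : F`_hi != 0.
  by move: Qy; rewrite /Q !mevalM !coefE !mulf_eq0 !negb_or => /andP[/andP[]].
move: Qy; rewrite QE // !mulf_eq0 !negb_or => /andP[/andP[F0 _] rnz].
by split; rewrite ?szF -?res_coprime.
Qed.
End Generic.

(** * Monomials of the characteristic polynomial *)

Section CharPolyTerms.
Variable n : nat.
Implicit Type t : {set 'I_n} * 'S_n.

(* A pair [(J, s)] with [s] supported on [J] indexes the monomial
   [\prod_(j in J) M j (s j) * Y ^+ (n - #|J|)] of the characteristic polynomial. *)
Definition cp_term t : bool := perm_on t.1 t.2.
Definition cp_edges t : {set 'I_n * 'I_n} := [set (j, t.2 j) | j in t.1].
Definition cp_degree t : nat := (n - #|t.1|)%N.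
(** The parity of [s], plus one sign for each entry taken from [- M] in ['X - M]. *)
Definition cp_sign t : bool := t.2 (+) odd #|t.1|.

(** The graph of [s] over [J] gives back [J], and also [s], which is the identity off [J]. *)
Lemma cp_edges_inj : {in cp_term &, injective cp_edges}.
Proof.
move=> [J s] [J' s'] /= Js Js' e.
have eE j : ((j \in J) = (j \in J')) /\ (j \in J -> s j = s' j).
  have mem (K : {set 'I_n}) (u : 'S_n) : (j \in K) = ((j, u j) \in cp_edges (K, u)).
    apply/idP/imsetP => [jK|[k /= kK [-> _]]//]; by exists j.
  have mem' (K : {set 'I_n}) (u : 'S_n) i : (j, i) \in cp_edges (K, u) -> j \in K /\ i = u j.
    by case/imsetP => k /= kK [-> ->].
  split.
    apply/idP/idP => [jJ|jJ'].
      by have := jJ; rewrite (mem J s) e => /mem'[].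
    by have := jJ'; rewrite (mem J' s') -e => /mem'[].
  by rewrite (mem J s) e => /mem'[].
have eJ : J = J' by apply/setP => j; case: (eE j).
congr (_, _) => //; apply/permP => j; have [|jJ] := boolP (j \in J).
  by case: (eE j) => _; apply.
by rewrite (out_perm Js) // (out_perm Js') // -eJ.
Qed.

Lemma cp_prod (K : comNzRingType) (a : 'I_n * 'I_n -> K) t :
  \prod_(e in cp_edges t) a e = \prod_(j in t.1) a (j, t.2 j).
Proof. by rewrite big_imset // => i j _ _ [->]. Qed.

(** In the Leibniz expansion, [J] collects the rows where [- M] is chosen rather than ['X]. Choosing
    ['X] in a row moved by [s] contributes 0, which leaves the [s] supported on [J]. *)
Lemma char_poly_sparse (K : comNzRingType) (M : 'M[K]_n) :
  char_poly M =
  sparse_poly cp_edges cp_degree cp_sign cp_term (fun e => M e.1 e.2).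
Proof.
rewrite /char_poly /determinant /sparse_poly.
transitivity (\sum_(s : 'S_n) \sum_(J : {set 'I_n} | perm_on J s)
    ((-1) ^+ cp_sign (J, s) * \prod_(e in cp_edges (J, s)) M e.1 e.2) *: 'X^(cp_degree (J, s))).
  apply: eq_bigr => s _.
  under eq_bigr => i _ do rewrite !mxE addrC.
  rewrite bigA_distr mulr_sumr [RHS]big_mkcond /=; apply: eq_big => [J|J _]; first by rewrite inE.
  have [Js|/subsetPn[i si iJ]] := boolP (perm_on J s); last first.
    rewrite (bigD1 i) //= (negPf iJ) eq_sym.
    by move: si; rewrite inE => /negPf->; rewrite mul0r mulr0.
  rewrite (bigID (mem J)) /= cp_prod /=.
  under eq_bigr => i iJ do rewrite iJ.
  under [X in _ * (_ * X)]eq_bigr => i iJ do rewrite (negPf iJ) (out_perm Js iJ) eqxx.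
  have -> : \prod_(i | i \notin J) 'X = 'X^(cp_degree (J, s)) :> {poly K}.
    rewrite prodr_const; congr (_ ^+ _).
    by rewrite /cp_degree /= -[n in (n - _)%N]card_ord -(cardC (mem J)) addKn.
  rewrite prodrN -rmorph_prod /= -mul_polyC rmorphM rmorphXn rmorphN1 /cp_sign /=.
  by rewrite [in RHS]signr_addb signr_odd !mulrA.
rewrite pair_big_dep /= (reindex (fun p => (p.2, p.1))) /=; last first.
  by exists (fun p => (p.2, p.1)) => [[]|[]].
by [].
Qed.
End CharPolyTerms.

(** * Slopes of the min-plus polynomial function *)

Section Tropical.
Variables (R : realType) (n : nat) (Gamma : 'I_n -> \bar R).
Hypothesis GammaNy : forall i, Gamma i != -oo%E.

Definition cap (y : R) (g : \bar R) : R := fine (Order.min y%:E g).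

Lemma capK y g : g != -oo%E -> (cap y g)%:E = Order.min y%:E g.
Proof.
move=> gNy; apply: fineK; rewrite fin_numE; case: g gNy => [g||] //= _.
- by rewrite /Order.min; case: ifP.
- by rewrite /Order.min ltry.
Qed.

Lemma cap_right y g : g != -oo%E ->
  \forall h \near 0^'+, cap (y + h) g = cap y g + h * (y%:E < g)%E%:R.
Proof.
case: g => [g||] // _; rewrite /cap.
- rewrite lte_fin; have [yg|gy] := ltP y g.
    near=> h; have hg : y + h <= g.
      rewrite -lerBrDl ltW //; near: h; apply: nbhs_right_lt; rewrite subr_gt0 //.
    by rewrite !min_l ?lee_fin ?(ltW yg) //= mulr1.
  near=> h; have h0 : 0 < h by near: h; apply: nbhs_right_gt.
  by rewrite !min_r ?lee_fin //= ?mulr0 ?addr0 // (le_trans gy) // lerDl ltW.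
- near=> h; have h0 : 0 < h by near: h; apply: nbhs_right_gt.
  by rewrite !min_l ?leey // ltry mulr1.
Unshelve. all: by end_near.
Qed.

Lemma cap_left y g : g != -oo%E ->
  \forall h \near 0^'+, cap (y - h) g = cap y g - h * (y%:E <= g)%E%:R.
Proof.
case: g => [g||] // _; rewrite /cap.
- rewrite lee_fin; have [yg|gy] := leP y g.
    near=> h; have h0 : 0 < h by near: h; apply: nbhs_right_gt.
    by rewrite !min_l ?lee_fin //= ?mulr1 // (le_trans _ yg) // gerBl ltW.
  near=> h; have hg : g <= y - h.
    rewrite lerBrDr -lerBrDl ltW //; near: h; apply: nbhs_right_lt; rewrite subr_gt0 //.
  by rewrite !min_r ?lee_fin ?(ltW gy) //= mulr0 subr0.
- near=> h; have h0 : 0 < h by near: h; apply: nbhs_right_gt.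
  by rewrite !min_l ?leey // mulr1.
Unshelve. all: by end_near.
Qed.

Lemma cap_infty g : g != -oo%E ->
  \forall y \near +oo, cap y g = if g == +oo%E then y else fine g.
Proof.
case: g => [g||] // _; rewrite /cap; near=> y.
- have gy : g <= y by near: y; apply: nbhs_pinfty_ge; rewrite num_real.
  by rewrite min_r ?lee_fin.
- by rewrite min_l ?leey.
Unshelve. all: by end_near.
Qed.

(** The polynomial function of a min-plus polynomial with leading coefficient 0 and roots [Gamma],
    at finite [y]. It is concave and piecewise affine, with right slope [num_gt] and left slope
    [num_ge]. *)
Definition cap_sum (y : R) : R := \sum_i cap y (Gamma i).
Definition num_gt (y : R) : nat := #|[pred i | (y%:E < Gamma i)%E]|.
Definition num_ge (y : R) : nat := #|[pred i | (y%:E <= Gamma i)%E]|.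
Definition num_infty : nat := #|[pred i | Gamma i == +oo%E]|.

Lemma natr_card (p : pred 'I_n) : \sum_i (p i)%:R = #|p|%:R :> R.
Proof.
by rewrite -sum1_card natr_sum [RHS]big_mkcond; apply: eq_bigr => i _;
  rewrite [i \in p]unfold_in; case: (p i).
Qed.

Lemma cap_sum_right y :
  \forall h \near 0^'+, cap_sum (y + h) = cap_sum y + h * (num_gt y)%:R.
Proof.
have : \forall h \near 0^'+, forall i,
    cap (y + h) (Gamma i) = cap y (Gamma i) + h * (y%:E < Gamma i)%E%:R.
  by apply: filter_forall => i; apply: cap_right.
apply: filterS => h e; rewrite /cap_sum (eq_bigr _ (fun i _ => e i)) big_split /=.
by rewrite -mulr_sumr natr_card.
Qed.

Lemma cap_sum_left y :
  \forall h \near 0^'+, cap_sum (y - h) = cap_sum y - h * (num_ge y)%:R.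
Proof.
have : \forall h \near 0^'+, forall i,
    cap (y - h) (Gamma i) = cap y (Gamma i) - h * (y%:E <= Gamma i)%E%:R.
  by apply: filter_forall => i; apply: cap_left.
apply: filterS => h e; rewrite /cap_sum (eq_bigr _ (fun i _ => e i)) big_split /=.
by rewrite sumrN -mulr_sumr natr_card.
Qed.

Variables (T : finType) (P : pred T) (k : T -> nat) (w : T -> R).
Hypothesis cap_sum_le : forall y t, P t -> cap_sum y <= w t + y *+ k t.
Hypothesis cap_sum_att : forall y, exists2 t, P t & w t + y *+ k t <= cap_sum y.

Definition tight (y : R) (t : T) : bool := P t && (w t + y *+ k t == cap_sum y).

(** The line of a tight term lies above [cap_sum] and touches it at [y]; a small step to the right
    compares the slopes. *)
Lemma tight_degree_ge y t : tight y t -> (num_gt y <= k t)%N.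
Proof.
move=> /andP[Pt /eqP e]; near (0 : R)^'+ => h.
have h0 : 0 < h by near: h; apply: nbhs_right_gt.
have := cap_sum_le (y + h) Pt.
have -> : cap_sum (y + h) = cap_sum y + h * (num_gt y)%:R by near: h; apply: cap_sum_right.
rewrite -e -(mulr_natr y) -(mulr_natr (y + h)) mulrDl addrA lerD2l.
by rewrite ler_pM2l // ler_nat.
Unshelve. all: by end_near.
Qed.

Lemma tight_degree_le y t : tight y t -> (k t <= num_ge y)%N.
Proof.
move=> /andP[Pt /eqP e]; near (0 : R)^'+ => h.
have h0 : 0 < h by near: h; apply: nbhs_right_gt.
have := cap_sum_le (y - h) Pt.
have -> : cap_sum (y - h) = cap_sum y - h * (num_ge y)%:R by near: h; apply: cap_sum_left.
rewrite -e -(mulr_natr y) -(mulr_natr (y - h)) mulrDl addrA lerD2l.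
by rewrite mulNr lerN2 ler_pM2l // ler_nat.
Unshelve. all: by end_near.
Qed.

(** A term attaining the minimum just to the right of [y] is tight at [y], because the finitely many
    non-tight terms have a positive gap there. Its slope is then at most the right slope, and
    [tight_degree_ge] gives equality. *)
Lemma tight_num_gt y : exists2 t, tight y t & k t = num_gt y.
Proof.
have : \forall h \near 0^'+, forall t, P t ->
    w t + (y + h) *+ k t <= cap_sum y + h * (num_gt y)%:R -> tight y t.
  apply: filter_forall => t; have [Pt|nPt] := boolP (P t); last by near=> h.
  have [tt|] := boolP (tight y t); first by near=> h.
  rewrite {1}/tight Pt /= neq_lt ltNge cap_sum_le //= -subr_gt0 => gap.
  near=> h => _; have h0 : 0 < h by near: h; apply: nbhs_right_gt.
  have hgap : h * (num_gt y)%:R < w t + y *+ k t - cap_sum y.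
    (* The successor keeps the divisor positive when [num_gt y] is 0. *)
    rewrite (le_lt_trans (y := h * ((num_gt y).+1)%:R)) //.
      by rewrite ler_pM2l // ler_nat.
    rewrite -ltr_pdivlMr // ?ltr0n //; near: h; apply: nbhs_right_lt.
    by rewrite divr_gt0.
  have : y *+ k t <= (y + h) *+ k t by rewrite lerMn2r lerDl ltW ?orbT.
  move=> ? ?; exfalso; lra.
move=> good; near (0 : R)^'+ => h.
have h0 : 0 < h by near: h; apply: nbhs_right_gt.
have [t Pt tle] := cap_sum_att (y + h).
have e : cap_sum (y + h) = cap_sum y + h * (num_gt y)%:R by near: h; apply: cap_sum_right.
rewrite e in tle.
have tt : tight y t by move: (t) Pt tle; near: h.
exists t => //; apply/eqP; rewrite eqn_leq tight_degree_ge // andbT.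
move: tle; case/andP: tt => _ /eqP<-.
by rewrite -(mulr_natr y) -(mulr_natr (y + h)) mulrDl addrA lerD2l ler_pM2l // ler_nat.
Unshelve. all: by end_near.
Qed.

Lemma tight_num_ge y : exists2 t, tight y t & k t = num_ge y.
Proof.
have : \forall h \near 0^'+, forall t, P t ->
    w t + (y - h) *+ k t <= cap_sum y - h * (num_ge y)%:R -> tight y t.
  apply: filter_forall => t; have [Pt|nPt] := boolP (P t); last by near=> h.
  have [tt|] := boolP (tight y t); first by near=> h.
  rewrite {1}/tight Pt /= neq_lt ltNge cap_sum_le //= -subr_gt0 => gap.
  near=> h => _; have h0 : 0 < h by near: h; apply: nbhs_right_gt.
  (* To the left, the line of [t] drops by [h * k t], so the threshold on [h] depends on the degree
     of [t]. *)
  have hgap : h * (k t)%:R < w t + y *+ k t - cap_sum y.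
    rewrite (le_lt_trans (y := h * ((k t).+1)%:R)) //.
      by rewrite ler_pM2l // ler_nat.
    rewrite -ltr_pdivlMr // ?ltr0n //; near: h; apply: nbhs_right_lt.
    by rewrite divr_gt0.
  rewrite -(mulr_natr y) in hgap; rewrite -(mulr_natr (y - h)) mulrBl => ?; exfalso.
  have : 0 <= h * (num_ge y)%:R by rewrite mulr_ge0 ?ler0n // ltW.
  lra.
move=> good; near (0 : R)^'+ => h.
have h0 : 0 < h by near: h; apply: nbhs_right_gt.
have [t Pt tle] := cap_sum_att (y - h).
have e : cap_sum (y - h) = cap_sum y - h * (num_ge y)%:R by near: h; apply: cap_sum_left.
rewrite e in tle.
have tt : tight y t by move: (t) Pt tle; near: h.
exists t => //; apply/eqP; rewrite eqn_leq tight_degree_le //=.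
move: tle; case/andP: tt => _ /eqP<-.
by rewrite -(mulr_natr y) -(mulr_natr (y - h)) mulrDl addrA lerD2l mulNr lerN2 ler_pM2l // ler_nat.
Unshelve. all: by end_near.
Qed.

(** For large [y] the slope of [cap_sum] is [num_infty], and a line of smaller slope would
    eventually pass below it. *)
Lemma num_infty_le t : P t -> (num_infty <= k t)%N.
Proof.
move=> Pt; rewrite leqNgt; apply/negP => km.
pose c := \sum_(i | Gamma i != +oo%E) fine (Gamma i).
near (pinfty_nbhs R) => y.
have y0 : 0 <= y by near: y; apply: nbhs_pinfty_ge; rewrite num_real.
have yc : w t - c < y by near: y; apply: nbhs_pinfty_gt; rewrite num_real.
have Sy : cap_sum y = y *+ num_infty + c.
  have e : forall i, cap y (Gamma i) = if Gamma i == +oo%E then y else fine (Gamma i).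
    by near: y; apply: filter_forall => i; apply: cap_infty.
  rewrite /cap_sum (eq_bigr _ (fun i _ => e i)) big_if /=.
  by rewrite sumr_const.
have := cap_sum_le y Pt; rewrite Sy.
have : y *+ k t + y <= y *+ num_infty.
  by rewrite -mulrSr ler_wpMn2l.
lra.
Unshelve. all: by end_near.
Qed.

End Tropical.

(** * The min-plus characteristic function as a minimum over monomials *)

Section CharPolyWeights.
Variables (R : realType) (n : nat) (A : 'M[\bar R]_n).
Hypothesis A_Rmin : forall i j, in_Rmin (A i j).

Definition cp_weight (t : {set 'I_n} * 'S_n) : \bar R := (\sum_(j in t.1) A j (t.2 j))%E.

Lemma mp_eval_char_poly_le y t : cp_term t ->
  (mp_eval (mp_char_poly A) y%:E <= cp_weight t + (y *+ cp_degree t)%:E)%E.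
Proof.
move=> ct; have kn : (cp_degree t < n.+1)%N by rewrite ltnS leq_subr.
rewrite /mp_eval; apply: (bigmin_inf (Ordinal kn)) => //=.
rewrite -EFin_natmul leeD2r //.
have szJ : (#|t.1| <= n)%N by rewrite -[n in (_ <= n)%N]card_ord max_card.
rewrite /mp_char_poly /=; case: eqP => [e|_].
  have /eqP : #|t.1| = 0%N by move: e szJ; rewrite /cp_degree; lia.
  by rewrite cards_eq0 /cp_weight => /eqP->; rewrite finset.big_set0.
apply: (bigmin_inf t.1); first by rewrite /cp_degree subKn.
exact: (bigmin_inf t.2).
Qed.

Lemma mp_eval_char_poly_att y : exists2 t : {set 'I_n} * 'S_n, cp_term t &
  (cp_weight t + (y *+ cp_degree t)%:E <= mp_eval (mp_char_poly A) y%:E)%E.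
Proof.
(* A bound [+oo] is met by any term; the empty set with the identity is always available. *)
have triv m : (+oo <= m)%E -> exists2 t : {set 'I_n} * 'S_n, cp_term t &
    (cp_weight t + (y *+ cp_degree t)%:E <= m)%E.
  by rewrite leye_eq => /eqP->; exists (finset.set0, 1%g); rewrite ?leey // /cp_term perm_on1.
case: (bigmin_leP _ _ _ _ (lexx (mp_eval (mp_char_poly A) y%:E))) => [/triv//|[k _ kle]].
rewrite /mp_char_poly in kle; case: eqP kle => [kn|_] kle.
  exists (finset.set0, 1%g); first by rewrite /cp_term perm_on1.
  by rewrite /cp_weight finset.big_set0 /cp_degree cards0 subn0 EFin_natmul; move: kle; rewrite kn.
case: (bigmin_leP _ _ _ _ (lexx (\big[Order.min/+oo%E]_(J : {set 'I_n} | #|J| == (n - k)%N)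
   \big[Order.min/+oo%E]_(s : 'S_n | perm_on J s) (\sum_(j in J) A j (s j))%E)))
   => [|[J /eqP szJ Jle]].
  rewrite leye_eq => /eqP e; move: kle; rewrite e -EFin_natmul => kle.
  by apply: triv; apply: le_trans kle; rewrite addye.
case: (bigmin_leP _ _ _ _ Jle) => [|[s Js sle]].
  rewrite leye_eq => /eqP e; move: kle; rewrite e -EFin_natmul => kle.
  by apply: triv; apply: le_trans kle; rewrite addye.
exists (J, s) => //; apply: le_trans kle.
rewrite /cp_degree szJ subKn -?EFin_natmul ?leeD2r // -ltnS; exact: ltn_ord.
Qed.

Variable Gamma : n.-tuple (\bar R).
Hypothesis Gamma_eig : mp_eigenvalues A Gamma.

Lemma Gamma_neqNy i : tnth Gamma i != -oo%E.
Proof. by case: Gamma_eig => G _ _; apply/eqP/G. Qed.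

Lemma mp_eval_cap_sum y :
  mp_eval (mp_char_poly A) y%:E = (cap_sum (tnth Gamma) y)%:E.
Proof.
case: Gamma_eig => _ _ /(_ y%:E)-> //.
rewrite /mp_char_poly /= eqxx add0e /cap_sum -sumEFin.
by apply: eq_bigr => i _; rewrite capK ?Gamma_neqNy.
Qed.

Lemma cp_weightNy t : cp_weight t != -oo%E.
Proof.
rewrite /cp_weight; elim/big_ind: _ => // x y; first by rewrite adde_eq_ninfty negb_or => -> ->.
by apply/eqP; apply: A_Rmin.
Qed.

Definition finite_term t := cp_term t && (cp_weight t != +oo%E).

Lemma finite_term_fineK t : cp_weight t != +oo%E -> (fine (cp_weight t))%:E = cp_weight t.
Proof. by move=> ty; rewrite fineK // fin_numE cp_weightNy ty. Qed.

Lemma finite_term_le y t : finite_term t ->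
  cap_sum (tnth Gamma) y <= fine (cp_weight t) + y *+ cp_degree t.
Proof.
move=> /andP[ct ty]; rewrite -lee_fin -mp_eval_cap_sum EFinD finite_term_fineK //.
exact: mp_eval_char_poly_le.
Qed.

Lemma finite_term_att y : exists2 t, finite_term t &
  fine (cp_weight t) + y *+ cp_degree t <= cap_sum (tnth Gamma) y.
Proof.
have [t ct] := mp_eval_char_poly_att y; rewrite mp_eval_cap_sum => tle.
have ty : cp_weight t != +oo%E.
  by apply: contraTneq tle => ->; rewrite addye.
by exists t; rewrite ?/finite_term ?ct // -lee_fin EFinD finite_term_fineK.
Qed.
End CharPolyWeights.

(** * Leading polynomials *)

Lemma separable_roots (C : closedFieldType) (p : {poly C}) :
  coprimep p p^`() -> exists rs : seq C,
    [/\ uniq rs, size rs = (size p).-1 & forall x, x \in rs -> root p x].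
Proof.
move=> cop; have [rs e] := closed_field_poly_normal p.
have p0 : p != 0.
  by apply: contraTneq cop => ->; rewrite derivC coprimep0 -size_poly_eq1 size_poly0.
have lc0 : lead_coef p != 0 by rewrite lead_coef_eq0.
exists rs; split=> [||x xrs].
- rewrite -separable_prod_XsubC unlock.
  by move: cop; rewrite {1 2}e derivZ coprimepZl // coprimepZr.
- by rewrite {1}e size_scale // size_prod_XsubC.
- by rewrite e rootZ // root_prod_XsubC.
Qed.

Lemma sparse_poly_shift (I T : finType) (E : T -> {set I}) (k : T -> nat) (sg : T -> bool)
    (K : comNzRingType) (P : pred T) (a : I -> K) (d : nat) :
  (forall t, P t -> (d <= k t)%N) ->
  sparse_poly E k sg P a = 'X^d * sparse_poly E (fun t => k t - d)%N sg P a.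
Proof.
move=> dk; rewrite mulr_sumr; apply: eq_bigr => t Pt.
by rewrite -scalerAr -exprD subnKC // dk.
Qed.

Section LeadingRoots.
Variables (R : realType) (n : nat) (A : 'M[\bar R]_n).
Hypothesis A_Rmin : forall i j, in_Rmin (A i j).
Variable Gamma : n.-tuple (\bar R).
Hypothesis Gamma_eig : mp_eigenvalues A Gamma.

Definition tight_term (y : R) : pred ({set 'I_n} * 'S_n) :=
  tight (tnth Gamma) (finite_term A) (@cp_degree n) (fine \o cp_weight A) y.

Definition leading_poly (y : R) (a : 'M[R[i]]_n) : {poly R[i]} :=
  sparse_poly (@cp_edges n) (@cp_degree n) (@cp_sign n) (tight_term y)
    (fun e => a e.1 e.2).

(** Injectivity is asked only among indices with the same exponent, since different exponents
    separate the discs by themselves. Infinite eigenvalues are left unconstrained. *)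
Definition simple_leading_roots (a : 'M[R[i]]_n) (lambda : 'I_n -> R[i]) : Prop :=
  (forall i y, tnth Gamma i = y%:E ->
     [/\ lambda i != 0, root (leading_poly y a) (lambda i) & leading_poly y a != 0]) /\
  (forall i j y, tnth Gamma i = y%:E -> tnth Gamma j = y%:E ->
     lambda i = lambda j -> i = j).

Let Gamma_neqNy' := Gamma_neqNy Gamma_eig.
Let fin_le := finite_term_le A_Rmin Gamma_eig.
Let fin_att := finite_term_att A_Rmin Gamma_eig.

Lemma num_gtD y : (num_gt (tnth Gamma) y + #|[pred i | tnth Gamma i == y%:E]|)%N =
  num_ge (tnth Gamma) y.
Proof.
rewrite /num_ge -(cardID [pred i | (y%:E < tnth Gamma i)%E] [pred i | (y%:E <= tnth Gamma i)%E]).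
congr (_ + _)%N; apply: eq_card => i; rewrite !inE.
  by rewrite andbC andb_idr // => /ltW.
by rewrite -leNgt eq_le.
Qed.

(** Removing the factor ['X^(num_gt y)] leaves a family whose degrees run from 0 to the multiplicity
    of [y], both attained, as [generic_sparse_poly_simple] requires. *)
Lemma generic_leading_roots (y : R) :
  (exists i, tnth Gamma i = y%:E) ->
  exists2 Q : mpoly (n * n) R[i], Q != 0 &
    forall v : 'rV[R[i]]_(n * n), meval (fun k => v 0 k) Q != 0 ->
    leading_poly y (vec_mx v) != 0 /\
    exists rs : seq R[i],
      [/\ uniq rs, size rs = #|[pred i | tnth Gamma i == y%:E]| &
          forall x, x \in rs -> x != 0 /\ root (leading_poly y (vec_mx v)) x].
Proof.
move=> [i0 ei0].
pose m := #|[pred i | tnth Gamma i == y%:E]|.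
have m0 : (0 < m)%N by apply/card_gt0P; exists i0; rewrite inE ei0.
pose lo := num_gt (tnth Gamma) y.
have lok t : tight_term y t -> (lo <= cp_degree t)%N.
  exact: (tight_degree_ge Gamma_neqNy' fin_le).
have kle t : tight_term y t -> (cp_degree t - lo <= m)%N.
  by move=> tt; rewrite leq_subLR num_gtD (tight_degree_le Gamma_neqNy' fin_le).
have ex0 : exists2 t, tight_term y t & (cp_degree t - lo)%N = 0%N.
  have [t tt kt] := tight_num_gt Gamma_neqNy' fin_le fin_att y.
  by exists t => //; rewrite kt subnn.
have exm : exists2 t, tight_term y t & (cp_degree t - lo)%N = m.
  have [t tt kt] := tight_num_ge Gamma_neqNy' fin_le fin_att y.
  by exists t => //; rewrite kt -num_gtD addKn.
pose idx (e : 'I_n * 'I_n) := mxvec_index e.1 e.2.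
have idx_inj : injective idx.
  have [g gK _] := curry_mxvec_bij n n.
  by apply: (can_inj (g := g)) => -[i j]; apply: (gK (i, j)).
have Einj : {in tight_term y &, injective (@cp_edges n)}.
  by move=> t u /andP[/andP[ct _] _] /andP[/andP[cu _] _]; apply: cp_edges_inj.
have [Q Q0 QP] := @generic_sparse_poly_simple _ _ (@cp_edges n)
  (fun t => cp_degree t - lo)%N (@cp_sign n) R[i] _ idx (tight_term y) m
  idx_inj Einj m0 kle ex0 exm.
exists Q => // v Qv; have := QP _ Qv.
rewrite (_ : _ \o idx = fun e => vec_mx v e.1 e.2); last by apply/funext => e /=; rewrite mxE.
set F := sparse_poly _ _ _ _ _ => -[F0 szF copF].
have FE : leading_poly y (vec_mx v) = 'X^lo * F by apply: sparse_poly_shift.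
have Fnz : F != 0 by rewrite -size_poly_gt0 szF.
split; first by rewrite FE mulf_neq0 // monic_neq0 // monicXn.
have [rs [Urs szrs rsP]] := separable_roots copF.
exists rs; split; rewrite // ?szrs ?szF // => x /rsP Fx.
rewrite FE rootM Fx orbT; split=> //.
by apply: contraNneq F0 => x0; move: Fx; rewrite x0 /root horner_coef0.
Qed.

Lemma generic_simple_leading_roots :
  generic_mx (fun a : 'M[R[i]]_n => exists lambda, simple_leading_roots a lambda).
Proof.
have /choice[Q QP] : forall y : R, exists Q : mpoly (n * n) R[i], Q != 0 /\
    ((exists i, tnth Gamma i = y%:E) ->
    forall v : 'rV[R[i]]_(n * n), meval (fun k => v 0 k) Q != 0 ->
    leading_poly y (vec_mx v) != 0 /\
    exists rs : seq R[i],
      [/\ uniq rs, size rs = #|[pred i | tnth Gamma i == y%:E]| &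
          forall x, x \in rs -> x != 0 /\ root (leading_poly y (vec_mx v)) x]).
  move=> y; have [/generic_leading_roots[Q Q0 QP]|n_ex] := pselect (exists i, tnth Gamma i = y%:E).
    by exists Q.
  by exists 1; split=> //; exact: oner_neq0.
(* At an infinite eigenvalue [fine] returns 0, and the extra factor [Q 0] is harmless, being
   nonzero. *)
exists (\prod_i Q (fine (tnth Gamma i))); split.
  by apply/eqP/prodf_neq0 => i _; case: (QP (fine (tnth Gamma i))).
move=> v /eqP; rewrite rmorph_prod => /prodf_neq0 Qv.
have /choice[rs rsP] : forall y : R, exists rs : seq R[i], (exists i, tnth Gamma i = y%:E) ->
   leading_poly y (vec_mx v) != 0 /\ 
      [/\ uniq rs, size rs = #|[pred i | tnth Gamma i == y%:E]| &
          forall x, x \in rs -> x != 0 /\ root (leading_poly y (vec_mx v)) x].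
  move=> y; have [ey|ney] := pselect (exists i, tnth Gamma i = y%:E); last by exists [::].
  have [i ei] := ey; have := Qv i isT; rewrite ei /= => Qy.
  by have [_ /(_ ey v Qy)[lp [rs rsP]]] := QP y; exists rs.
pose cls y := enum [pred i | tnth Gamma i == y%:E].
(* The occurrences of [y] in [Gamma], numbered by their position in [cls y], receive the roots of
   [rs y] in that order. *)
pose lambda i := let y := fine (tnth Gamma i) in nth 0 (rs y) (index i (cls y)).
have idx_lt i y : tnth Gamma i = y%:E -> (index i (cls y) < size (rs y))%N.
  move=> ei; have [|_ [_ -> _]] := rsP y; first by exists i.
  by rewrite cardE index_mem mem_enum inE ei.
exists lambda; split=> [i y ei|i j y ei ej].
  have [|lp [_ _ rsy]] := rsP y; first by exists i.
  have [] := rsy (lambda i); last by split.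
  by rewrite /lambda ei /= mem_nth // idx_lt.
have [|lp [Urs _ rsy]] := rsP y; first by exists i.
rewrite /lambda ei ej /= => /eqP; rewrite nth_uniq ?idx_lt // => /eqP e.
rewrite -(@nth_index _ i i (cls y)) ?e ?nth_index // mem_enum inE ?ei ?ej //.
Qed.
End LeadingRoots.

(** * Asymptotics of the eigenvalues *)

Section ComplexModulus.
Variable R : realType.
Implicit Types x y z : R[i].

Lemma normr_normc z : `|z| = (normc z)%:C.
Proof. by case: z. Qed.

Lemma normc_ge0 z : 0 <= normc z.
Proof. by rewrite -lecR -normr_normc normr_ge0. Qed.

Lemma ler_normc x y : normc (x + y) <= normc x + normc y.
Proof. by rewrite -lecR rmorphD /= -!normr_normc ler_normD. Qed.

Lemma normc_opp z : normc (- z) = normc z.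
Proof. by apply: (@complexI R); rewrite -!normr_normc normrN. Qed.

Lemma normcB x y : normc (x - y) = normc (y - x).
Proof. by rewrite -normc_opp opprB. Qed.

Lemma normc_real (r : R) : normc r%:C = `|r|.
Proof. by rewrite /normc /= expr0n addr0 sqrtr_sqr. Qed.

Lemma normc_eq0 z : (normc z == 0) = (z == 0).
Proof.
apply/eqP/eqP => [/eq0_normc //|->]; exact: normc0.
Qed.

Lemma normc_prod (I : Type) (s : seq I) (P : pred I) (f : I -> R[i]) :
  normc (\prod_(i <- s | P i) f i) = \prod_(i <- s | P i) normc (f i).
Proof. by elim/big_ind2: _ => [|? ? ? ? <- <-|//]; rewrite ?normc1 ?normcM. Qed.

(** The norm of [R[i]] takes values in [R[i]]; [normc] brings the estimates back to [R], positive
    elements of [R[i]] being real. *)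
Lemma cvg_normcP (T : Type) (F : set_system T) (f : T -> R[i]) (l : R[i]) :
  Filter F ->
  ((f : T -> R[i]^o) @ F --> (l : R[i]^o)) <->
  (forall d : R, 0 < d -> \forall x \near F, normc (f x - l) < d).
Proof.
move=> FF; split=> [fl d d0|fl].
  have dC : 0 < d%:C by rewrite ltcR.
  have /(@cvgrPdist_lt _ (R[i]^o : normedModType R[i]))/(_ _ dC) := fl.
  by apply: filterS => x; rewrite distrC normr_normc ltcR.
apply/(@cvgrPdist_lt _ (R[i]^o : normedModType R[i])) => e e0.
have eR : e = (complex.Re e)%:C.
  by case: e e0 => a b; rewrite ltcE /= => /andP[/eqP-> _].
have d0 : 0 < complex.Re e by rewrite -ltcR -eR.
apply: filterS (fl _ d0) => x xd.
by rewrite distrC normr_normc eR ltcR.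
Qed.

Lemma cvg_sumC (T I : Type) (F : set_system T) (s : seq I) (P : pred I)
    (f : I -> T -> R[i]^o) (l : I -> R[i]^o) : Filter F ->
  (forall i, P i -> f i @ F --> l i) ->
  (fun u : T => \sum_(i <- s | P i) f i u) @ F --> (\sum_(i <- s | P i) l i : R[i]^o).
Proof. by move=> FF; apply: cvg_big; apply: add_continuous. Qed.

Lemma cvg_prodC (T I : Type) (F : set_system T) (s : seq I) (P : pred I)
    (f : I -> T -> R[i]^o) (l : I -> R[i]^o) : Filter F ->
  (forall i, P i -> f i @ F --> l i) ->
  (fun u : T => \prod_(i <- s | P i) f i u) @ F --> (\prod_(i <- s | P i) l i : R[i]^o).
Proof. by move=> FF; apply: cvg_big; apply: mul_continuous. Qed.

Lemma continuous_powRC (s e : R) : 0 < e ->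
  (fun r : R => (r `^ s)%:C : R[i]^o) @ e --> ((e `^ s)%:C : R[i]^o).
Proof.
move=> e0; apply/cvg_normcP => d d0.
have c : {for e, continuous (fun r : R => r `^ s)}.
  apply/differentiable_continuous/derivable1_diffP.
  by have [] := is_derive1_powR s e0.
have /cvgrPdist_lt/(_ _ d0) := c; apply: filterS => x.
by rewrite distrC -rmorphB normc_real.
Qed.

Lemma cvg_powRC0 (s : R) : 0 < s ->
  (fun r : R => (r `^ s)%:C : R[i]^o) @ 0^'+ --> (0 : R[i]^o).
Proof.
move=> s0; apply/cvg_normcP => d d0.
have /cvgrPdist_lt/(_ _ d0) := powR_cvg0 s0; apply: filterS => x.
by rewrite distrC !subr0 normc_real.
Qed.
End ComplexModulus.

(** The monomials left out contain an entry of exponent [+oo], which is zero near 0. *)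
Definition finite_char_poly (R : realType) (n : nat) (A : 'M[\bar R]_n)
    (M : 'M[R[i]]_n) : {poly R[i]} :=
  sparse_poly (@cp_edges n) (@cp_degree n) (@cp_sign n) (finite_term A)
    (fun p => M p.1 p.2).

(** * Convergence of the rescaled characteristic polynomial *)

Section Scaling.
Variables (R : realType) (n : nat) (A : 'M[\bar R]_n).
Hypothesis A_Rmin : forall i j, in_Rmin (A i j).
Variable Gamma : n.-tuple (\bar R).
Hypothesis Gamma_eig : mp_eigenvalues A Gamma.
Variables (a : 'M[R[i]]_n) (calA : R -> 'M[R[i]]_n).
Hypothesis calA_asymp :
  forall i j, asymp_eq (fun e => calA e i j) (a i j) (A i j).

Lemma cp_weight_eqy (t : {set 'I_n} * 'S_n) :
  (cp_weight A t == +oo%E) = [exists j in t.1, A j (t.2 j) == +oo%E].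
Proof. by apply: esum_eqy => j _; apply/eqP; apply: A_Rmin. Qed.

Lemma finite_term_entry t j : cp_weight A t != +oo%E -> j \in t.1 ->
  A j (t.2 j) \is a fin_num.
Proof.
rewrite cp_weight_eqy negb_exists_in => /forall_inP wt jt.
by rewrite fin_numE wt // andbT; apply/eqP; apply: A_Rmin.
Qed.

Lemma finite_term_weightE t : cp_weight A t != +oo%E ->
  fine (cp_weight A t) = \sum_(j in t.1) fine (A j (t.2 j)).
Proof.
move=> wt; rewrite -[RHS]/(fine (_%:E)) -sumEFin; congr fine.
by apply: eq_bigr => j jt; rewrite fineK // finite_term_entry.
Qed.

Lemma near_char_poly :
  \forall e \near 0^'+, char_poly (calA e) =
    finite_char_poly A (calA e).
Proof.
have : \forall e \near 0^'+, forall t, cp_weight A t = +oo%E ->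
    \prod_(j in t.1) calA e j (t.2 j) = 0.
  apply: filter_forall => t; have [wt|wt] := eqVneq (cp_weight A t) +oo%E; last first.
    by near=> e => /eqP; rewrite (negPf wt).
  have /exists_inP[j jt /eqP Aj] : [exists j in t.1, A j (t.2 j) == +oo%E].
    by rewrite -cp_weight_eqy wt.
  have := calA_asymp j (t.2 j); rewrite /asymp_eq Aj.
  by apply: filterS => e e0 _; rewrite (bigD1 j) //= e0 mul0r.
apply: filterS => e e0; rewrite char_poly_sparse /finite_char_poly /sparse_poly [RHS]big_mkcondr.
apply: eq_bigr => t ct; case: eqP => //= /e0 p0.
by rewrite cp_prod /= p0 mulr0 scale0r.
Unshelve. all: by end_near.
Qed.

Lemma cvg_scaled_entry t j : cp_weight A t != +oo%E -> j \in t.1 ->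
  (fun e : R => (e `^ (- fine (A j (t.2 j))))%:C * calA e j (t.2 j) : R[i]^o) @ 0^'+ -->
  (a j (t.2 j) : R[i]^o).
Proof.
move=> wt jt; have := calA_asymp j (t.2 j).
by have := finite_term_entry wt jt; case: (A j _).
Qed.

Lemma powRC_prod (e : R) (I : Type) (s : seq I) (P : pred I) (f : I -> R) : 0 < e ->
  (e `^ (\sum_(i <- s | P i) f i))%:C = \prod_(i <- s | P i) (e `^ f i)%:C :> R[i].
Proof.
move=> e0; elim/big_rec2: _ => [|i x y _ IH]; first by rewrite powRr0.
by rewrite powRD ?(gt_eqF e0) ?implybT // rmorphM /= IH.
Qed.

Lemma cvg_scaled_char_poly (y : R) (z : R[i]) :
  (fun e : R => (e `^ (- cap_sum (tnth Gamma) y))%:C *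
     (char_poly (calA e)).[z * (e `^ y)%:C] : R[i]^o) @ 0^'+ -->
  ((leading_poly A Gamma y a).[z] : R[i]^o).
Proof.
(* The exponent of [e] that remains after rescaling: nonnegative on finite terms, and zero exactly
   on the tight ones. *)
pose gap t := fine (cp_weight A t) + y *+ cp_degree t - cap_sum (tnth Gamma) y.
pose f t (e : R) : R[i]^o := (-1) ^+ cp_sign t *
  (\prod_(j in t.1) ((e `^ (- fine (A j (t.2 j))))%:C * calA e j (t.2 j))) *
  z ^+ cp_degree t * (e `^ gap t)%:C.
have : (fun e => \sum_(t | finite_term A t) f t e : R[i]^o) @ 0^'+ -->
    (\sum_(t | finite_term A t) (if gap t == 0 then
       (-1) ^+ cp_sign t * (\prod_(j in t.1) a j (t.2 j)) * z ^+ cp_degree t else 0) : R[i]^o).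
  apply: cvg_sumC => t /andP[ct wt].
  have main : (fun e : R => (-1) ^+ cp_sign t *
      (\prod_(j in t.1) ((e `^ (- fine (A j (t.2 j))))%:C * calA e j (t.2 j))) *
      z ^+ cp_degree t : R[i]^o) @ 0^'+ -->
     ((-1) ^+ cp_sign t * (\prod_(j in t.1) a j (t.2 j)) * z ^+ cp_degree t : R[i]^o).
    apply: cvgM; last exact: cvg_cst.
    apply: cvgM; first exact: cvg_cst.
    by apply: cvg_prodC => j jt; apply: cvg_scaled_entry.
  rewrite /f; case: eqP => [->|/eqP gap0].
    by under eq_fun do rewrite powRr0 mulr1.
  have gap_gt0 : 0 < gap t.
    rewrite lt_neqAle eq_sym gap0 subr_ge0.
    by apply: (finite_term_le A_Rmin Gamma_eig); rewrite /finite_term ct.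
  rewrite -[X in _ --> X](mulr0 ((-1) ^+ cp_sign t *
    (\prod_(j in t.1) a j (t.2 j)) * z ^+ cp_degree t)).
  by apply: cvgM; [exact: main | exact: cvg_powRC0].
have -> : \sum_(t | finite_term A t) (if gap t == 0 then
       (-1) ^+ cp_sign t * (\prod_(j in t.1) a j (t.2 j)) * z ^+ cp_degree t else 0) =
    (leading_poly A Gamma y a).[z].
  rewrite /leading_poly /sparse_poly horner_sum -big_mkcondr /=.
  apply: eq_big => [t|t _]; first by rewrite /tight_term /tight /= /gap subr_eq0.
  by rewrite hornerZ hornerXn cp_prod.
apply: cvg_trans; apply: near_eq_cvg.
have e_gt0 : \forall e \near (0 : R)^'+, 0 < e by apply: nbhs_right_gt.
near=> e; have e0 : 0 < e by near: e.
have -> : char_poly (calA e) =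
    finite_char_poly A (calA e) by near: e; apply: near_char_poly.
rewrite /finite_char_poly /sparse_poly horner_sum mulr_sumr.
apply: eq_bigr => t /andP[ct wt].
rewrite hornerZ hornerXn cp_prod /= /f exprMn big_split /=.
have -> : gap t = - cap_sum (tnth Gamma) y + y *+ cp_degree t + \sum_(j in t.1) fine (A j (t.2 j)).
  by rewrite /gap finite_term_weightE // addrC addrA [X in _ = X]addrAC.
have powD r s : e `^ (r + s) = e `^ r * e `^ s by rewrite powRD // (gt_eqF e0) implybT.
have realM (r s : R) : (r * s)%:C = r%:C * s%:C :> R[i] by rewrite rmorphM.
have prodE : (e `^ (\sum_(j in t.1) fine (A j (t.2 j))))%:C =
    \prod_(j in t.1) (e `^ fine (A j (t.2 j)))%:C :> R[i] by exact: powRC_prod.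
rewrite powD powD realM realM prodE.
have -> : (e `^ (y *+ cp_degree t))%:C = (e `^ y)%:C ^+ cp_degree t :> R[i].
  by rewrite -(mulr_natr y) powRrM powR_mulrn ?powR_ge0 // rmorphXn.
have : (\prod_(j in t.1) (e `^ (- fine (A j (t.2 j))))%:C) *
    \prod_(j in t.1) (e `^ (fine (A j (t.2 j))))%:C = 1 :> R[i].
  rewrite -big_split big1 //= => j _; rewrite -realM -powD.
  by rewrite addNr powRr0.
have comb (u v s p zk E Y : R[i]) : u * v = 1 ->
    E * (s * p * (zk * Y)) = s * (u * p) * zk * (E * Y * v).
  move=> uv; transitivity (u * v * (E * (s * p * (zk * Y)))); last by ring.
  by rewrite uv mul1r.
by move=> uv; apply/esym/comb.
Unshelve. all: by end_near.
Qed.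
End Scaling.

(** The points [l + d / k.+1] with [k < size p] are too many to be all roots. *)
Lemma exists_close_nonroot (R : realType) (p : {poly R[i]}) (l : R[i]) (d : R) :
  p != 0 -> 0 < d -> exists2 m, normc (m - l) <= d & p.[m] != 0.
Proof.
move=> p0 d0; apply: contrapT => nex.
pose rs := [seq l + (d / k.+1%:R)%:C | k <- iota 0 (size p)].
have Urs : uniq rs.
  rewrite map_inj_uniq ?iota_uniq // => i j /addrI /(@complexI R).
  move/(mulfI (lt0r_neq0 d0))/invr_inj/eqP; rewrite eqr_nat => /eqP[]; exact.
have rP : all (root p) rs.
  apply/allP => _ /mapP[k _ ->]; apply/negPn/negP => nr; apply: nex.
  exists (l + (d / k.+1%:R)%:C) => //.
  rewrite addrAC subrr add0r normc_real ger0_norm; last exact: divr_ge0 (ltW d0) _.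
  by rewrite ler_pdivrMr ?ltr0n // ler_peMr ?ler1n // ltW.
by have := max_poly_roots p0 rP Urs; rewrite size_map size_iota ltnn.
Qed.

Section Roots.
Variables (R : realType) (n : nat) (A : 'M[\bar R]_n).
Hypothesis A_Rmin : forall i j, in_Rmin (A i j).
Variable Gamma : n.-tuple (\bar R).
Hypothesis Gamma_eig : mp_eigenvalues A Gamma.
Variables (a : 'M[R[i]]_n) (calA : R -> 'M[R[i]]_n) (lambda : 'I_n -> R[i]).
Hypothesis calA_asymp :
  forall i j, asymp_eq (fun e => calA e i j) (a i j) (A i j).
Hypothesis lambda_simple : simple_leading_roots A Gamma a lambda.

Definition finite_eig i : bool := tnth Gamma i != +oo%E.

(** Distances are measured after division by [e ^ gamma], so that the discs get a radius independent
    of [e]. *)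
Definition offset (i : 'I_n) (e : R) (z : R[i]) : R :=
  normc (z * (e `^ (- fine (tnth Gamma i)))%:C - lambda i).

Lemma finite_eigE i : finite_eig i -> tnth Gamma i = (fine (tnth Gamma i))%:E.
Proof.
by move=> fi; rewrite fineK // fin_numE (Gamma_neqNy Gamma_eig).
Qed.

(* If every root stayed at scaled distance [d] from [lambda i], then moving from
   [lambda i] to a nearby non-root [m] of the leading polynomial would multiply
   the modulus of the scaled polynomial by at most [2 ^ n]; but its value tends
   to 0 at [lambda i] and not at [m]. *)
Lemma near_root i d : finite_eig i -> 0 < d ->
  \forall e \near 0^'+, exists2 z, root (char_poly (calA e)) z & offset i e z < d.
Proof.
move=> fi d0; have iE := finite_eigE fi; set y := fine _ in iE.
have [/(_ i y iE)[l0 Fl F0] _] := lambda_simple.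
have [m ml Fm] := exists_close_nonroot (lambda i) F0 d0.
pose q e z := (e `^ (- cap_sum (tnth Gamma) y))%:C * (char_poly (calA e)).[z * (e `^ y)%:C].
have ql := cvg_scaled_char_poly A_Rmin Gamma_eig calA_asymp (y := y) (z := lambda i).
have qm := cvg_scaled_char_poly A_Rmin Gamma_eig calA_asymp (y := y) (z := m).
rewrite (rootP Fl) in ql.
set F := leading_poly A Gamma y a in Fl F0 Fm ql qm.
have Fm0 : 0 < normc F.[m] by rewrite lt_neqAle eq_sym normc_eq0 Fm normc_ge0.
(* A value [q e m] of modulus below [c] cannot lie within [c] of [F.[m]]. The division by [2 ^ n] in
   [c1] compensates the factor lost in [key]. *)
pose c := normc F.[m] / 2%:R.
have c0 : 0 < c by rewrite divr_gt0.
have c1 : 0 < c / 2%:R ^+ n by rewrite divr_gt0 // exprn_gt0.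
near=> e; have e0 : 0 < e by near: e; apply: nbhs_right_gt.
have ey0 : 0 < e `^ y by rewrite powR_gt0.
have qle : normc (q e (lambda i)) < c / 2%:R ^+ n.
  rewrite -[q e _]subr0; near: e.
  by have /cvg_normcP/(_ _ c1) := ql.
have qme : normc (q e m - F.[m]) < c.
  by near: e; have /cvg_normcP/(_ _ c0) := qm.
apply: contrapT => nex.
have far r : root (char_poly (calA e)) r -> d * e `^ y <= normc (lambda i * (e `^ y)%:C - r).
  move=> rr; rewrite leNgt; apply/negP => rd; apply: nex; exists r => //.
  rewrite /offset -/y powRN -(ltr_pM2r ey0) (le_lt_trans _ rd) //.
  have Yn : e `^ y = normc (e `^ y)%:C by rewrite normc_real gtr0_norm.
  rewrite [X in _ * X <= _]Yn -normcM mulrBl normcB.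
  by rewrite -mulrA -rmorphM mulVf ?gt_eqF //= mulr1.
have [rs rsE] := closed_field_poly_normal (char_poly (calA e)).
rewrite (monicP (char_poly_monic _)) scale1r in rsE.
have szrs : size rs = n.
  by have := size_char_poly (calA e); rewrite rsE size_prod_XsubC => -[].
have normP z : normc (char_poly (calA e)).[z] = \prod_(r <- rs) normc (z - r).
  by rewrite rsE horner_prod normc_prod; apply: eq_bigr => r _; rewrite hornerXsubC.
have key : normc (q e m) <= 2%:R ^+ n * normc (q e (lambda i)).
  rewrite /q !normcM mulrCA ler_wpM2l ?normc_ge0 // !normP.
  have -> : 2%:R ^+ n = \prod_(r <- rs) 2%:R :> R.
    by rewrite big_const_seq count_predT szrs iter_mulr_1.
  rewrite -big_split big_seq [leRHS]big_seq; apply: ler_prod => r rrs.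
  rewrite normc_ge0 /=.
  have rr : root (char_poly (calA e)) r by rewrite rsE root_prod_XsubC.
  have -> : m * (e `^ y)%:C - r = (m - lambda i) * (e `^ y)%:C + (lambda i * (e `^ y)%:C - r).
    by ring.
  apply: le_trans (ler_normc _ _) _; rewrite mulr_natl mulr2n lerD2r.
  apply: le_trans (far r rr); rewrite normcM normc_real gtr0_norm //.
  by rewrite ler_wpM2r // ltW.
have : normc F.[m] <= normc (q e m) + normc (q e m - F.[m]).
  rewrite -[X in normc X <= _](subKr (q e m)) (le_trans (ler_normc _ _)) //.
  by rewrite normc_opp.
have : 2%:R ^+ n * normc (q e (lambda i)) < c.
  by rewrite mulrC -ltr_pdivlMr // exprn_gt0.
rewrite /c in qme *; lra.
Unshelve. all: by end_near.
Qed.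
End Roots.

(** * Disjoint discs and factorization of the characteristic polynomial *)

Section Separation.
Variables (R : realType) (n : nat) (A : 'M[\bar R]_n).
Hypothesis A_Rmin : forall i j, in_Rmin (A i j).
Variable Gamma : n.-tuple (\bar R).
Hypothesis Gamma_eig : mp_eigenvalues A Gamma.
Variables (a : 'M[R[i]]_n) (calA : R -> 'M[R[i]]_n) (lambda : 'I_n -> R[i]).
Hypothesis calA_asymp :
  forall i j, asymp_eq (fun e => calA e i j) (a i j) (A i j).
Hypothesis lambda_simple : simple_leading_roots A Gamma a lambda.

Local Notation finite_eig := (finite_eig Gamma).
Local Notation offset := (offset Gamma lambda).

(** The bound on [lambda i] keeps the discs away from 0, hence from zero eigenvalues and from discs
    of larger exponent; the bound on differences separates discs of equal exponent. *)
Definition separating (rho : R) : Prop :=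
  [/\ 0 < rho, forall i, finite_eig i -> rho *+ 2 <= normc (lambda i) &
   forall i j, finite_eig i -> tnth Gamma i = tnth Gamma j -> i != j ->
     rho *+ 2 <= normc (lambda i - lambda j)].

Lemma exists_separating : exists rho, separating rho.
Proof.
have small (c : R) : 0 < c -> \forall r \near 0^'+, r *+ 2 <= c.
  move=> c0; near=> r; rewrite -mulr_natr -ler_pdivlMr // ltW //.
  by near: r; apply: nbhs_right_lt; rewrite divr_gt0.
have n1 : \forall r \near (0 : R)^'+, forall i, finite_eig i -> r *+ 2 <= normc (lambda i).
  apply: filter_forall => i; have [fi|nfi] := boolP (finite_eig i); last by near=> r.
  have [/(_ i _ (finite_eigE Gamma_eig fi))[l0 _ _] _] := lambda_simple.
  have : 0 < normc (lambda i) by rewrite lt_neqAle eq_sym normc_eq0 l0 normc_ge0.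
  by move/small; apply: filterS.
have n2 : \forall r \near (0 : R)^'+, forall i j, finite_eig i ->
    tnth Gamma i = tnth Gamma j -> i != j -> r *+ 2 <= normc (lambda i - lambda j).
  apply: filter_forall => i; apply: filter_forall => j.
  have [fi|nfi] := boolP (finite_eig i); last by near=> r.
  have [eij|/eqP neij] := eqVneq (tnth Gamma i) (tnth Gamma j); last by near=> r.
  have [ij|nij] := eqVneq i j; first by near=> r.
  have iE := finite_eigE Gamma_eig fi.
  have : 0 < normc (lambda i - lambda j).
    rewrite lt_neqAle eq_sym normc_eq0 subr_eq0 normc_ge0 andbT.
    apply: contra_neq nij; have [_ h] := lambda_simple; apply: (h _ _ _ iE).
    by rewrite -eij.
  by move/small; apply: filterS.
near (0 : R)^'+ => r; exists r; split; first by near: r; apply: nbhs_right_gt.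
  by near: r.
by near: r.
Unshelve. all: by end_near.
Qed.

(** Rescaled by the smaller exponent, points of disc [j] tend to 0, whereas those of disc [i] keep a
    modulus above [rho]. *)
Lemma near_disjoint_lt (rho : R) i j : separating rho -> finite_eig i -> finite_eig j ->
  (tnth Gamma i < tnth Gamma j)%E ->
  \forall e \near 0^'+, forall z, offset i e z < rho -> offset j e z < rho -> False.
Proof.
move=> [rho0 rho_l _] fi fj; rewrite (finite_eigE Gamma_eig fi) (finite_eigE Gamma_eig fj) lte_fin.
rewrite /offset; set yi := fine _; set yj := fine _ => yij.
have c0 : 0 < rho / (normc (lambda j) + rho) by rewrite divr_gt0 // ltr_wpDl ?normc_ge0.
near=> e => z; have e0 : 0 < e by near: e; apply: nbhs_right_gt.
have small : e `^ (yj - yi) < rho / (normc (lambda j) + rho).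
  near: e; have yij0 : 0 < yj - yi by rewrite subr_gt0.
  have /cvgrPdist_lt/(_ _ c0) := powR_cvg0 yij0.
  by apply: filterS => x; rewrite sub0r normrN ger0_norm ?powR_ge0.
have -> : (e `^ (- yi))%:C = (e `^ (- yj))%:C * (e `^ (yj - yi))%:C :> R[i].
  rewrite -rmorphM -powRD ?(gt_eqF e0) ?implybT //; congr ((_ `^ _)%:C); lra.
rewrite mulrA; set u := z * _; set p := e `^ _ in small *.
move=> ui uj.
have p0 : 0 < p by rewrite powR_gt0.
have u_le : normc u < normc (lambda j) + rho.
  rewrite -(subrK (lambda j) u) (le_lt_trans (ler_normc _ _)) // addrC; lra.
have up_lt : normc (u * p%:C) < rho.
  rewrite normcM normc_real gtr0_norm // mulrC.
  rewrite -(@divfK _ (normc (lambda j) + rho) _ rho); last by rewrite gt_eqF // ltr_wpDl ?normc_ge0.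
  by apply: ltr_pM => //; first [exact: normc_ge0 | exact: ltW].
have : normc (lambda i) <= normc (u * p%:C) + normc (u * p%:C - lambda i).
  rewrite -[X in normc X <= _](subKr (u * p%:C)) (le_trans (ler_normc _ _)) //.
  by rewrite normc_opp.
have := rho_l i fi; rewrite mulr2n; lra.
Unshelve. all: by end_near.
Qed.

Lemma near_disjoint rho : separating rho ->
  \forall e \near 0^'+, forall i j, finite_eig i -> finite_eig j ->
    forall z, offset i e z < rho -> offset j e z < rho -> i = j.
Proof.
move=> sep; apply: filter_forall => i; apply: filter_forall => j.
have [fi|nfi] := boolP (finite_eig i); last by near=> r.
have [fj|nfj] := boolP (finite_eig j); last by near=> r.
have [lt|lt|eij] := ltgtP (tnth Gamma i) (tnth Gamma j).
- by apply: filterS (near_disjoint_lt sep fi fj lt) => e h _ _ z zi zj; case: (h z).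
- by apply: filterS (near_disjoint_lt sep fj fi lt) => e h _ _ z zi zj; case: (h z).
near=> e => _ _ z; have [_ _ /(_ i j fi eij) sepij] := sep.
rewrite /offset -eij; set u := z * _ => ui uj; apply/eqP/negPn/negP => /sepij.
have : normc (lambda i - lambda j) <= normc (u - lambda i) + normc (u - lambda j).
  rewrite normcB (_ : lambda j - lambda i = (u - lambda i) + - (u - lambda j)); last by ring.
  by rewrite (le_trans (ler_normc _ _)) // normc_opp.
rewrite mulr2n; lra.
Unshelve. all: by end_near.
Qed.

Lemma offset0 i e : offset i e 0 = normc (lambda i).
Proof. by rewrite /offset mul0r sub0r normc_opp. Qed.

(** The roots found in the discs are distinct by disjointness, and nonzero. The cofactor of
    ['X^num_infty] has degree the number of finite eigenvalues, so these roots exhaust it. *)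
Lemma near_factorization rho d : separating rho -> 0 < d -> d <= rho ->
  \forall e \near 0^'+, exists r : 'I_n -> R[i],
    [/\ char_poly (calA e) = \prod_i ('X - (r i)%:P),
        forall i, finite_eig i -> offset i e (r i) < d &
        forall i, ~~ finite_eig i -> r i = 0].
Proof.
move=> sep d0 drho.
have nroot : \forall e \near 0^'+, forall i, finite_eig i ->
    exists2 z, root (char_poly (calA e)) z & offset i e z < d.
  apply: filter_forall => i; have [fi|nfi] := boolP (finite_eig i); last by near=> r.
  have := near_root A_Rmin Gamma_eig calA_asymp lambda_simple fi d0.
  by apply: filterS.
near=> e.
have /choice[r rP] : forall i, exists z, if finite_eig i
    then root (char_poly (calA e)) z /\ offset i e z < d else z = 0.
  move=> i; case: (boolP (finite_eig i)) => [fi|_]; last by exists 0.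
  have : forall i, finite_eig i -> exists2 z, root (char_poly (calA e)) z & offset i e z < d.
    by near: e.
  by move=> /(_ i fi)[z rz oz]; exists z.
have rF i : finite_eig i -> root (char_poly (calA e)) (r i) /\ offset i e (r i) < d.
  by move=> fi; have := rP i; rewrite fi.
exists r; split=> [|i /rF[]//|i /negPf nfi]; last by have := rP i; rewrite nfi.
have disj : forall i j, finite_eig i -> finite_eig j ->
    forall z, offset i e z < rho -> offset j e z < rho -> i = j.
  by near: e; apply: near_disjoint.
have r0 i : finite_eig i -> r i != 0.
  move=> fi; apply/eqP => ri0; have [_] := rF i fi; rewrite ri0 offset0.
  have [rho0 /(_ i fi) + _] := sep; rewrite mulr2n; lra.
have Pe : char_poly (calA e) = finite_char_poly A (calA e).
  by near: e; exact: (near_char_poly A_Rmin calA_asymp).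
rewrite /finite_char_poly in Pe.
pose m := num_infty (tnth Gamma).
have mle t : finite_term A t -> (m <= cp_degree t)%N.
  by apply: (num_infty_le (Gamma_neqNy Gamma_eig) (finite_term_le A_Rmin Gamma_eig)).
rewrite (sparse_poly_shift _ _ _ mle) in Pe.
set Q := sparse_poly _ _ _ _ _ in Pe.
have Qmon : Q \is monic by rewrite -(monicMl _ (monicXn _ m)) -Pe char_poly_monic.
have szQ : (m + size Q)%N = n.+1.
  have := size_char_poly (calA e); rewrite Pe size_Mmonic // ?size_polyXn ?addSn //.
  by rewrite monic_neq0 // monicXn.
pose fin := [pred i | finite_eig i].
pose rs := [seq r i | i <- enum fin].
have Urs : uniq rs.
  rewrite map_inj_in_uniq ?enum_uniq // => i j; rewrite !mem_enum !inE => fi fj rij.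
  apply: (disj i j fi fj (r i)).
    exact: lt_le_trans (rF i fi).2 drho.
  by rewrite rij; apply: lt_le_trans (rF j fj).2 drho.
have rsQ : all (root Q) rs.
  rewrite /rs all_map; apply/allP => i; rewrite mem_enum inE /= => fi.
  have [+ _] := rF i fi; rewrite Pe rootM => /orP[|//].
  by rewrite /root hornerXn expf_eq0 (negPf (r0 i fi)) andbF.
have cfin : (m + #|fin|)%N = n.
  rewrite /m /num_infty -[RHS]card_ord -(cardC fin) addnC; congr (_ + _)%N.
  by apply: eq_card => i; rewrite !inE negbK.
have szrs : size Q = (size rs).+1.
  rewrite size_map -cardE; apply/eqP; rewrite -(eqn_add2l m) szQ addnS.
  by rewrite eqSS cfin.
have QE := all_roots_prod_XsubC szrs rsQ.
rewrite uniq_rootsE (monicP Qmon) scale1r in QE.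
rewrite Pe (QE Urs) (bigID fin) /= mulrC big_map big_enum /=; congr (_ * _).
under eq_bigr => i /negPf nfi.
  have -> : r i = 0 by have := rP i; rewrite nfi.
  rewrite subr0; over.
rewrite prodr_const; congr (_ ^+ _).
by apply: eq_card => i; rewrite !inE; exact: (esym (negbK _)).
Unshelve. all: by end_near.
Qed.
End Separation.

Lemma near_at_right0 (R : realType) (P : R -> Prop) :
  (\forall e \near 0^'+, P e) -> exists2 e0, 0 < e0 & forall e, e \in `]0, e0[ -> P e.
Proof.
rewrite near_withinE => /nbhs_ballP[d /= d0 H]; exists d => // e.
rewrite in_itv /= => /andP[e0 ed]; apply: H => //.
by rewrite /ball /= sub0r normrN gtr0_norm.
Qed.

Lemma at_right0_near (R : realType) (P : R -> Prop) (e0 : R) :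
  0 < e0 -> (forall e, e \in `]0, e0[ -> P e) -> \forall e \near 0^'+, P e.
Proof.
move=> e00 H; near=> e; apply: H; rewrite in_itv /=; apply/andP; split.
  by near: e; apply: nbhs_right_gt.
by near: e; apply: nbhs_right_lt.
Unshelve. all: by end_near.
Qed.

Lemma root_prod_finP (F : fieldType) (I : finType) (r : I -> F) z :
  reflect (exists i, z = r i) (root (\prod_i ('X - (r i)%:P)) z).
Proof.
rewrite /root horner_prod; apply: (iffP (prodf_eq0 _ _)) => [[i _]|[i ->]].
  by rewrite hornerXsubC subr_eq0 => /eqP->; exists i.
by exists i; rewrite // hornerXsubC subrr.
Qed.

Lemma exists_close_root (R : realType) (n : nat) (r : 'I_n -> R[i]) z d : 0 < d ->
  normc (\prod_i ('X - (r i)%:P)).[z] < d ^+ n -> exists i, normc (z - r i) < d.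
Proof.
move=> d0 small; apply: contrapT => far; move: small; apply/negP; rewrite -leNgt.
have -> : d ^+ n = \prod_(i < n) d by rewrite prodr_const card_ord.
rewrite horner_prod normc_prod; apply: ler_prod => i _; rewrite ltW //= hornerXsubC.
by rewrite leNgt; apply/negP => lt; apply: far; exists i.
Qed.

Lemma cvg_char_poly (R : realType) (n : nat) (M : R -> 'M[R[i]]_n) (e : R) z :
  (forall i j, (fun x => M x i j : R[i]^o) @ e --> (M e i j : R[i]^o)) ->
  (fun x => (char_poly (M x)).[z] : R[i]^o) @ e --> ((char_poly (M e)).[z] : R[i]^o).
Proof.
move=> Mc; have E x : (char_poly (M x)).[z] = \sum_(t | cp_term t)
    (-1) ^+ cp_sign t * (\prod_(j in t.1) M x j (t.2 j)) * z ^+ cp_degree t.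
  rewrite char_poly_sparse horner_sum; apply: eq_bigr => t _.
  by rewrite hornerZ hornerXn cp_prod.
rewrite E; under eq_fun do rewrite E.
apply: cvg_sumC => t _; apply: cvgM; last exact: cvg_cst.
apply: cvgM; first exact: cvg_cst.
by apply: cvg_prodC => j _; apply: Mc.
Qed.

(** * Continuous eigenvalue branches *)

Section Branches.
Variables (R : realType) (n : nat) (A : 'M[\bar R]_n).
Hypothesis A_Rmin : forall i j, in_Rmin (A i j).
Variable Gamma : n.-tuple (\bar R).
Hypothesis Gamma_eig : mp_eigenvalues A Gamma.
Variables (a : 'M[R[i]]_n) (calA : R -> 'M[R[i]]_n) (lambda : 'I_n -> R[i]).
Hypothesis calA_asymp :
  forall i j, asymp_eq (fun e => calA e i j) (a i j) (A i j).
Hypothesis lambda_simple : simple_leading_roots A Gamma a lambda.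

Local Notation finite_eig := (finite_eig Gamma).
Local Notation offset := (offset Gamma lambda).

(** There are two radii: the roots lie within [d] of their centres, while uniqueness holds up to
    [rho]. The ring in between contains no root. *)
Definition isolated (rho d e : R) (r : 'I_n -> R[i]) : Prop :=
  [/\ 0 < e, char_poly (calA e) = \prod_i ('X - (r i)%:P),
      forall i, finite_eig i -> offset i e (r i) < d,
      forall i, ~~ finite_eig i -> r i = 0 &
      forall i z, finite_eig i -> root (char_poly (calA e)) z -> offset i e z < rho ->
        z = r i].

Lemma near_isolated rho d : separating Gamma lambda rho -> 0 < d -> d <= rho ->
  \forall e \near 0^'+, exists r, isolated rho d e r.
Proof.
move=> sep d0 drho; near=> e.
have [r [P rfin rinf]] : exists r : 'I_n -> R[i],
    [/\ char_poly (calA e) = \prod_i ('X - (r i)%:P),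
        forall i, finite_eig i -> offset i e (r i) < d &
        forall i, ~~ finite_eig i -> r i = 0].
  by near: e; apply: (near_factorization A_Rmin Gamma_eig calA_asymp lambda_simple sep).
have disj : forall i j, finite_eig i -> finite_eig j ->
    forall z, offset i e z < rho -> offset j e z < rho -> i = j.
  by near: e; apply: (near_disjoint Gamma_eig sep).
have e0 : 0 < e by near: e; apply: nbhs_right_gt.
exists r; split=> //.
move=> i z fi; rewrite P => /root_prod_finP[j ->] oi.
have [fj|nfj] := boolP (finite_eig j).
  rewrite (disj i j fi fj (r j) oi) //.
  exact: lt_le_trans (rfin j fj) drho.
have [rho0 /(_ i fi) + _] := sep; move: oi; rewrite rinf // offset0 mulr2n => ? ?; exfalso; lra.
Unshelve. all: by end_near.
Qed.

(** [isolated] gives unrelated lists [r] for different [e]. Selecting a root by its disc yields one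
    function of [e], and uniqueness forces the choice made by [xget]. *)
Definition branch (rho : R) (i : 'I_n) (e : R) : R[i] :=
  if finite_eig i then
    xget 0 [set z | root (char_poly (calA e)) z /\ offset i e z < rho]
  else 0.

Lemma branchE rho d e r i : d <= rho -> isolated rho d e r -> branch rho i e = r i.
Proof.
move=> drho [_ P rfin rinf uniq]; rewrite /branch.
have [fi|nfi] := boolP (finite_eig i); last by rewrite rinf.
case: xgetP => [z _ [rz oz]|/(_ (r i))]; first exact: uniq.
case; split; last exact: lt_le_trans (rfin i fi) drho.
by rewrite P; apply/root_prod_finP; exists i.
Qed.

Hypothesis calA_germ : forall i j, is_germ (fun e => calA e i j).

Lemma near_calA_continuous : \forall e \near 0^'+,
  forall i j, (fun x => calA x i j : R[i]^o) @ e --> (calA e i j : R[i]^o).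
Proof.
apply: filter_forall => i; apply: filter_forall => j.
have [e0 [k [e00 k0 cont _]]] := calA_germ i j.
exact: at_right0_near e00 cont.
Qed.

(** For [x] near [e] the polynomial is small at the old root [z], so it has a root close to [z];
    this root is still in disc [i], and uniqueness makes it the value of the branch. *)
Lemma branch_continuous rho e0 i : 0 < rho ->
  (forall e, e \in `]0, e0[ -> exists r, isolated rho rho e r) ->
  forall e, e \in `]0, e0[ ->
  (forall i j, (fun x => calA x i j : R[i]^o) @ e --> (calA e i j : R[i]^o)) ->
  (branch rho i : R -> R[i]^o) @ e --> (branch rho i e : R[i]^o).
Proof.
move=> rho0 iso e ee0 cont.
have [fi|nfi] := boolP (finite_eig i); last first.
  by rewrite /branch (negPf nfi); exact: cvg_cst.
have [r re] := iso e ee0; have [e_gt0 P rfin _ _] := re.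
rewrite (branchE _ (lexx rho) re); set z := r i.
set y := fine (tnth Gamma i).
have zrho : offset i e z < rho by apply: rfin.
(* Half of the slack of [z] in its disc: one half pays for the displacement of the root, the other
   for the change of scale from [e] to [x]. *)
pose eta := (rho - offset i e z) / 2%:R.
have eta0 : 0 < eta by rewrite divr_gt0 // subr_gt0.
pose K := e `^ (- y) + 1.
have K0 : 0 < K by rewrite ltr_wpDl // powR_ge0.
have powc := continuous_powRC (s := - y) e_gt0.
apply/cvg_normcP => d d0.
pose delta := Num.min d (eta / K).
have delta0 : 0 < delta by rewrite lt_min d0 divr_gt0.
near=> x.
have xe0 : x \in `]0, e0[ by near: x; apply: near_in_itvoo.
have [rx rxP] := iso x xe0; have [x_gt0 Px _ _ uniqx] := rxP.
have Pz : normc (char_poly (calA x)).[z] < delta ^+ n.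
  rewrite -[_.[z]]subr0 -[X in _ - X](_ : (char_poly (calA e)).[z] = 0); last first.
    by apply/rootP; rewrite P; apply/root_prod_finP; exists i.
  near: x; have /cvg_normcP h := cvg_char_poly (z := z) cont.
  by apply: h; rewrite exprn_gt0.
rewrite Px in Pz; have [j zj] := exists_close_root delta0 Pz.
have [zjd zjeta] : normc (z - rx j) < d /\ normc (z - rx j) < eta / K.
  by move: zj; rewrite lt_min => /andP[].
suff -> : branch rho i x = rx j by rewrite normcB.
rewrite (branchE i (lexx rho) rxP); symmetry; apply: uniqx => //.
  by rewrite Px; apply/root_prod_finP; exists j.
have oz : normc (z * (x `^ (- y))%:C - z * (e `^ (- y))%:C) < eta.
  near: x; have /cvg_normcP h : (fun x => z * (x `^ (- y))%:C : R[i]^o) @ e -->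
      (z * (e `^ (- y))%:C : R[i]^o) by apply: cvgM; [exact: cvg_cst | exact: powc].
  exact: h.
have xK : x `^ (- y) < K.
  rewrite -ltrBlDl; near: x; have /cvg_normcP/(_ _ ltr01) := powc.
  apply: filterS => x; rewrite -rmorphB normc_real; apply: le_lt_trans; exact: ler_norm.
have x0 : 0 < x `^ (- y) by rewrite powR_gt0.
have step : normc ((rx j - z) * (x `^ (- y))%:C) < eta.
  rewrite normcM normc_real gtr0_norm // normcB.
  apply: le_lt_trans (_ : normc (z - rx j) * K < eta).
    by rewrite ler_wpM2l ?normc_ge0 // ltW.
  by rewrite -ltr_pdivlMr.
rewrite /offset -/y.
have -> : rx j * (x `^ (- y))%:C - lambda i = (rx j - z) * (x `^ (- y))%:C +
   ((z * (x `^ (- y))%:C - z * (e `^ (- y))%:C) + (z * (e `^ (- y))%:C - lambda i)) by ring.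
apply: le_lt_trans (ler_normc _ _) _.
have := ler_normc (z * (x `^ (- y))%:C - z * (e `^ (- y))%:C) (z * (e `^ (- y))%:C - lambda i).
rewrite -/(offset i e z) => h.
have : eta + (eta + offset i e z) = rho by rewrite /eta; field.
move: step oz h; rewrite /offset -/y; lra.
Unshelve. all: by end_near.
Qed.

(** The modulus is at most a constant times [e ^ y]. The exponent [|y| + 1] is positive, as
    [is_germ] demands, and so is its sum with [y], which absorbs the constant near 0. *)
Lemma branch_bound rho i : 0 < rho ->
  (\forall e \near 0^'+, exists r, isolated rho rho e r) ->
  \forall e \near 0^'+, normc (branch rho i e) <= e `^ (- (`|fine (tnth Gamma i)| + 1)).
Proof.
move=> rho0 iso.
have [fi|nfi] := boolP (finite_eig i); last first.
  near=> e; rewrite /branch (negPf nfi); rewrite (_ : normc 0 = 0) ?powR_ge0 //.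
  exact: normc0.
set y := fine (tnth Gamma i).
have s0 : 0 < y + (`|y| + 1) by have := ler_norm (- y); rewrite normrN; lra.
have c0 : 0 < (normc (lambda i) + rho)^-1 by rewrite invr_gt0 ltr_wpDl ?normc_ge0.
near=> e; have [r re] : exists r, isolated rho rho e r by near: e.
have [e0 _ /(_ i fi) ri _ _] := re; rewrite (branchE i (lexx rho) re).
have small : e `^ (y + (`|y| + 1)) < (normc (lambda i) + rho)^-1.
  near: e; have /cvgrPdist_lt/(_ _ c0) := powR_cvg0 s0.
  by apply: filterS => x; rewrite sub0r normrN ger0_norm ?powR_ge0.
have ey0 : 0 < e `^ y by rewrite powR_gt0.
have rE : r i = r i * (e `^ (- y))%:C * (e `^ y)%:C.
  by rewrite -mulrA -rmorphM powRN mulVf ?gt_eqF //= mulr1.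
rewrite rE normcM normc_real gtr0_norm //.
have uE : normc (r i * (e `^ (- y))%:C) < normc (lambda i) + rho.
  rewrite -[X in normc X](subrK (lambda i)); apply: le_lt_trans (ler_normc _ _) _.
  by rewrite addrC ltrD2l.
apply: le_trans (_ : (normc (lambda i) + rho) * e `^ y <= _).
  by rewrite ler_wpM2r ?powR_ge0 // ltW.
have pk : 0 < e `^ (`|y| + 1) by rewrite powR_gt0.
rewrite powRN -[leRHS]mul1r ler_pdivlMr // -mulrA.
rewrite -powRD ?(gt_eqF e0) ?implybT //.
by rewrite mulrC -ler_pdivlMr ?mul1r ?ltW // ltr_wpDl ?normc_ge0.
Unshelve. all: by end_near.
Qed.

Lemma exists_eigenvalue_germs : exists L, eigenvalue_germs calA L.
Proof.
have [rho sep] := exists_separating Gamma_eig lambda_simple.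
have [rho0 _ _] := sep.
have iso := near_isolated sep rho0 (lexx rho).
exists (branch rho); split; last first.
  apply: filterS iso => e [r re]; have [_ -> _ _ _] := re.
  by apply: eq_bigr => i _; rewrite (branchE i (lexx rho) re).
move=> i.
have [e1 e10 iso1] := near_at_right0 iso.
have [e2 e20 cont] := near_at_right0 near_calA_continuous.
have [e3 e30 bound] := near_at_right0 (branch_bound i rho0 iso).
exists (Num.min e1 (Num.min e2 e3)), (`|fine (tnth Gamma i)| + 1).
have sub e : e \in `]0, Num.min e1 (Num.min e2 e3)[ ->
    [/\ e \in `]0, e1[, e \in `]0, e2[ & e \in `]0, e3[].
  by rewrite !in_itv /= !lt_min => /andP[-> /and3P[-> -> ->]].
split.
- by rewrite !lt_min e10 e20 e30.
- by rewrite ltr_wpDl.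
- by move=> e /sub[ee1 ee2 _]; apply: (branch_continuous rho0 iso1) => //; apply: cont.
- by move=> e /sub[_ _ ee3]; rewrite normr_normc lecR; apply: bound.
Qed.
End Branches.

Lemma cvg_normc (R : realType) (T : Type) (F : set_system T) (f : T -> R[i]) (l : R[i]) :
  Filter F -> (f : T -> R[i]^o) @ F --> (l : R[i]^o) ->
  (fun x => normc (f x)) @ F --> normc l.
Proof.
move=> FF /cvg_normcP fl; apply/cvgrPdist_lt => d d0; apply: filterS (fl d d0) => x.
apply: le_lt_trans; rewrite ler_distl; apply/andP; split.
  by rewrite lerBlDr addrC -{1}(subrK l (f x)) ler_normc.
by rewrite -{1}(subrKC (f x) l) (normcB (f x)) ler_normc.
Qed.

Lemma prod_XsubC_perm (F : fieldType) (n : nat) (f g : 'I_n -> F) :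
  \prod_i ('X - (f i)%:P) = \prod_i ('X - (g i)%:P) ->
  exists p : 'S_n, forall i, f i = g (p i).
Proof.
have tE (h : 'I_n -> F) : \prod_(x <- [tuple h i | i < n]) ('X - x%:P) =
    \prod_i ('X - (h i)%:P).
  by rewrite big_tuple; apply: eq_bigr => i _; rewrite tnth_mktuple.
rewrite -!tE => /prod_XsubC_eq.
move/tuple_permP => [p pE]; exists p => i.
have /val_inj/(congr1 (fun t => tnth t i)) := pE.
by rewrite !tnth_mktuple.
Qed.

(** * Asymptotics of an arbitrary continuous labelling *)

Section Labelling.
Variables (R : realType) (n : nat) (A : 'M[\bar R]_n).
Hypothesis A_Rmin : forall i j, in_Rmin (A i j).
Variable Gamma : n.-tuple (\bar R).
Hypothesis Gamma_eig : mp_eigenvalues A Gamma.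
Variables (a : 'M[R[i]]_n) (calA : R -> 'M[R[i]]_n) (lambda : 'I_n -> R[i]).
Hypothesis calA_asymp :
  forall i j, asymp_eq (fun e => calA e i j) (a i j) (A i j).
Hypothesis lambda_simple : simple_leading_roots A Gamma a lambda.

Local Notation finite_eig := (finite_eig Gamma).
Local Notation offset := (offset Gamma lambda).

(* On an interval where the roots inside the disc of radius [rho] already lie
   in the disc of radius [rho / 2], the intermediate value theorem forbids a
   continuous root from leaving the disc. *)
Lemma root_stays rho e0 (f : R -> R[i]) i e e' : 0 < rho -> finite_eig i ->
  (forall x, x \in `]0, e0[ -> exists r, isolated Gamma calA lambda rho (rho / 2%:R) x r) ->
  (forall x, x \in `]0, e0[ -> root (char_poly (calA x)) (f x)) ->
  {in `]0, e0[, continuous (f : R -> R[i]^o)} ->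
  e \in `]0, e0[ -> e' \in `]0, e0[ ->
  offset i e (f e) < rho -> offset i e' (f e') < rho.
Proof.
move=> rho0 fi iso froot fcont ee0 e'e0 fe; rewrite ltNge; apply/negP => fe'.
pose g x := offset i x (f x).
have gsmall x : x \in `]0, e0[ -> g x < rho -> g x < rho / 2%:R.
  move=> xe0 gx; have [r [_ _ rfin _ uniq]] := iso x xe0.
  by rewrite /g (uniq i (f x) fi (froot x xe0) gx) rfin.
have gcont x : x \in `]0, e0[ -> {for x, continuous g}.
  move=> xe0; have x0 : 0 < x by move: xe0; rewrite in_itv /= => /andP[].
  apply: cvg_normc; apply: cvgB; last exact: cvg_cst.
  by apply: cvgM; [exact: fcont | exact: continuous_powRC].
have itv_sub u v x : u \in `]0, e0[ -> v \in `]0, e0[ -> x \in `[u, v] -> x \in `]0, e0[.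
  rewrite !in_itv /= => /andP[u0 _] /andP[_ v1] /andP[ux xv].
  by rewrite (lt_le_trans u0 ux) (le_lt_trans xv v1).
(* The value [3 * rho / 4] lies in the ring between [rho / 2] and [rho], which no root enters. *)
have noval x : x \in `]0, e0[ -> g x <> rho * 3%:R / 4%:R.
  move=> xe0 gx; have := gsmall x xe0; rewrite gx => h.
  have : rho * 3%:R / 4%:R < rho by lra.
  by move/h; lra.
have gcontw u v : u \in `]0, e0[ -> v \in `]0, e0[ -> {within `[u, v], continuous g}.
  move=> ue ve; apply: continuous_in_subspaceT => x; rewrite inE /= => xuv.
  by apply: gcont; apply: itv_sub xuv.
have gee : g e < rho / 2%:R by apply: gsmall.
have [le|lt] := leP e e'.
  have [|c /(itv_sub _ _ _ ee0 e'e0) ce gc] :=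
    IVT le (gcontw _ _ ee0 e'e0) (v := rho * 3%:R / 4%:R).
    rewrite min_l ?max_r; rewrite -/(g e') in fe'; lra.
  exact: noval gc.
have [|c /(itv_sub _ _ _ e'e0 ee0) ce gc] :=
  IVT (ltW lt) (gcontw _ _ e'e0 ee0) (v := rho * 3%:R / 4%:R).
  rewrite min_r ?max_l; rewrite -/(g e') in fe'; lra.
exact: noval gc.
Qed.

(** [root_stays] ties each eigenvalue to one disc on a whole interval, so a permutation read at a
    single point is valid throughout; the limit follows by shrinking the inner radius. *)
Lemma eigenvalue_asymptotics (L : 'I_n -> R -> R[i]) : eigenvalue_germs calA L ->
  exists s : 'S_n, forall i, first_order_asymp (L (s i)) (lambda i) (tnth Gamma i).
Proof.
move=> [Lgerm LP].
have [rho sep] := exists_separating Gamma_eig lambda_simple.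
have [rho0 rho_l _] := sep.
have rho2 : 0 < rho / 2%:R by rewrite divr_gt0.
have rho2_le : rho / 2%:R <= rho by lra.
have Lcont : \forall e \near 0^'+, forall j, (L j : R -> R[i]^o) @ e --> (L j e : R[i]^o).
  apply: filter_forall => j; have [e0 [k [e00 _ cont _]]] := Lgerm j.
  exact: at_right0_near e00 cont.
have [e1 e10 iso] := near_at_right0
  (near_isolated A_Rmin Gamma_eig calA_asymp lambda_simple sep rho2 rho2_le).
have [e2 e20 PL] := near_at_right0 LP.
have [e3 e30 cont] := near_at_right0 Lcont.
pose e0 := Num.min e1 (Num.min e2 e3).
have e00 : 0 < e0 by rewrite !lt_min e10 e20.
have sub e : e \in `]0, e0[ -> [/\ e \in `]0, e1[, e \in `]0, e2[ & e \in `]0, e3[].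
  by rewrite !in_itv /= !lt_min => /andP[-> /and3P[-> -> ->]].
have Lroot j e : e \in `]0, e0[ -> root (char_poly (calA e)) (L j e).
  by move=> /sub[_ ee2 _]; rewrite (PL e ee2); apply/root_prod_finP; exists j.
have iso0 e : e \in `]0, e0[ -> exists r, isolated Gamma calA lambda rho (rho / 2%:R) e r.
  by move=> /sub[ee1 _ _]; apply: iso.
have stays i j e e' : finite_eig i -> e \in `]0, e0[ -> e' \in `]0, e0[ ->
    offset i e (L j e) < rho -> offset i e' (L j e') < rho.
  move=> fi ee0 e'e0; apply: (root_stays rho0 fi iso0) => // x xe0; first exact: Lroot.
  by have [_ _ xe3] := sub x xe0; apply: cont.
(* Any point of the interval would do; the labels of [L] and [r] are matched there. *)
pose e := e0 / 2%:R.
have ee0 : e \in `]0, e0[ by rewrite in_itv /=; apply/andP; split; rewrite /e; lra.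
have [r [_ Pr rfin rinf _]] := iso0 e ee0.
have [|s sP] := @prod_XsubC_perm _ _ r (fun j => L j e).
  by rewrite -Pr; apply: PL; case: (sub e ee0).
exists s => i; have [fi|nfi] := boolP (finite_eig i); last first.
  have -> : tnth Gamma i = +oo%E by apply/eqP; rewrite -[_ == _]negbK.
  split; last by right.
  apply: at_right0_near e00 _ => e' e'e0.
  have [r' [_ Pr' r'fin r'inf _]] := iso0 e' e'e0.
  have := Lroot (s i) e' e'e0; rewrite Pr' => /root_prod_finP[j Lj].
  (* An eigenvalue in disc [j] at [e'] would also be there at [e]; but at [e] it is 0, at scaled
     distance at least [2 * rho] from that centre. *)
  have [fj|nfj] := boolP (finite_eig j); last by rewrite Lj r'inf.
  have : offset j e' (L (s i) e') < rho by rewrite Lj (lt_le_trans (r'fin j fj)).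
  move/(stays j (s i) e' e fj e'e0 ee0); rewrite -sP (rinf i nfi) offset0.
  by have := rho_l j fj; rewrite mulr2n => ? ?; exfalso; lra.
have iE := finite_eigE Gamma_eig fi.
have [/(_ i _ iE)[l0 _ _] _] := lambda_simple.
split; last by left; split; [rewrite iE | exact/eqP].
rewrite iE /asymp_eq; apply/cvg_normcP => d d0.
have dmin0 : 0 < Num.min d rho by rewrite lt_min d0.
have dmin_le : Num.min d rho <= rho by rewrite ge_min lexx orbT.
near=> x.
have xe0 : x \in `]0, e0[.
  by rewrite in_itv /=; apply/andP; split; near: x; [exact: nbhs_right_gt | exact: nbhs_right_lt].
have [r' [_ _ r'fin _ uniq]] : exists r', isolated Gamma calA lambda rho (Num.min d rho) x r'.
  by near: x; apply: (near_isolated A_Rmin Gamma_eig calA_asymp lambda_simple sep).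
(* Membership in the disc of radius [rho] is carried over from [e]; uniqueness in that disc improves
   it to distance below [d]. *)
have off : offset i x (L (s i) x) < rho.
  apply: (stays i (s i) e x) => //; rewrite -sP; exact: lt_le_trans (rfin i fi) rho2_le.
have := r'fin i fi; rewrite -(uniq i _ fi (Lroot (s i) x xe0) off) lt_min => /andP[+ _].
by rewrite /offset mulrC.
Unshelve. all: by end_near.
Qed.
End Labelling.

Unset Implicit Arguments.

Theorem theorem7p4 (R : realType) (n : nat) (A : 'M[\bar R]_n)
    (Gamma : n.-tuple (\bar R))
    (A_Rmin : forall i j : 'I_n, in_Rmin (A i j))
    (Gamma_eig : mp_eigenvalues A Gamma) :
  generic_mx (fun a : 'M[R[i]]_n =>
    forall calA : R -> 'M[R[i]]_n,
      (forall i j : 'I_n, is_germ (fun e : R => calA e i j)) ->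
      (forall i j : 'I_n,
         asymp_eq (fun e : R => calA e i j) (a i j) (A i j)) ->
      (exists L : 'I_n -> R -> R[i], eigenvalue_germs calA L) /\
      (forall L : 'I_n -> R -> R[i], eigenvalue_germs calA L ->
         exists (s : 'S_n) (lambda : 'I_n -> R[i]) (Lambda : n.-tuple (\bar R)),
           [/\ forall i : 'I_n,
                 first_order_asymp (L (s i)) (lambda i) (tnth Lambda i),
               forall i j : 'I_n, (i <= j)%N ->
                 (tnth Lambda i <= tnth Lambda j)%E
             & Lambda = Gamma])).
Proof.
have [Q [Q0 QP]] := generic_simple_leading_roots A_Rmin Gamma_eig.
exists Q; split=> // v /QP[lambda lambda_simple] calA calA_germ calA_asymp.
split.
  exact: (exists_eigenvalue_germs A_Rmin Gamma_eig calA_asymp lambda_simple calA_germ).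
move=> L LP.
have [s sP] := eigenvalue_asymptotics A_Rmin Gamma_eig calA_asymp lambda_simple LP.
by exists s, lambda, Gamma; split=> //; case: Gamma_eig.
Qed.
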